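(* Let $a,b>0$, $\Phi(\lambda)=a\ln(1+\lambda/b)$, and $f\in W^{1,1}_0(0,\infty)$. Let $v(t,x)\in C^{1,1}((0,\infty),W^{1,1}_0(0,\infty);[0,\infty))$ be the solution to $$\begin{cases}\dfrac{\partial}{\partial t}v(t,x)=-\mathcal{D}_x^\Phi v(t,x), & t>0,\ x\in(0,\infty),\\[4pt] v(0,x)=f(x), & x\in(0,\infty),\\[2pt] v(t,x)=0, & t>0,\ x\in(-\infty,0].\end{cases}$$ Then $$v(t,x)=\int_0^x f(x-y)\,h(t,y)\,dy=\mathbf{E}_0\left[f(x-H_t),\,t<L_x\right].$$
   Context: Fix $a,b>0$. The gamma subordinator $H=\{H_t\}_{t\ge0}$ is the subordinator started at $H_0=0$ with $\mathbf{E}_0[e^{-\lambda H_t}]=e^{-t\Phi(\lambda)}$, $\lambda\ge0$, where $\Phi(\lambda)=a\ln(1+\lambda/b)=a\int_0^\infty(1-e^{-\lambda y})\frac{e^{-by}}{y}\,dy$. For $t>0$ the law of $H_t$ has density $h(t,x)=\frac{b^{at}}{\Gamma(at)}x^{at-1}e^{-bx}$ for $x>0$ (and $0$ for $x\le0$). The inverse process is $L_x=\inf\{s>0:H_s\notin(0,x)\}$, $x>0$. The notation $\mathbf{E}_0[X,A]$ means $\mathbf{E}_0[X\,\mathbf{1}_A]$. The tail of the Lévy measure is $\overline{\Pi}(y)=a\int_y^\infty\frac{e^{-bz}}{z}\,dz$, and the Riemann–Liouville type operator is $$\mathcal{D}_x^\Phi\varphi(x)=\frac{d}{dx}\int_0^x\varphi(x-y)\,\overline{\Pi}(y)\,dy$$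 for continuous $\varphi$ on $\mathbb{R}$ with $\varphi(x)=0$ for $x\le0$. Spaces: $W^{1,1}(0,\infty)=\{\psi\in L^1(0,\infty):\psi'\in L^1(0,\infty)\}$ and $W^{1,1}_0(0,\infty)=\{\psi\in W^{1,1}(0,\infty):\psi(0)=0\}$. The class $C^{1,1}((0,\infty),W^{1,1}_0(0,\infty);[0,\infty))$ consists of functions $(t,x)\mapsto v(t,x)$ with values in $[0,\infty)$, continuously differentiable in $t\in(0,\infty)$ for each fixed $x>0$ and in $x\in(0,\infty)$ for each fixed $t>0$, with $v(t,\cdot)\in W^{1,1}_0(0,\infty)$ for each $t>0$. Solutions are taken within the class where Laplace-transform techniques in each variable apply, i.e. for fixed value of the other variable the function is continuous on $(0,\infty)$ and bounded by a constant (the set $\mathcal{M}_0\cap C(0,\infty)$, where $\mathcal{M}_\eta$ denotes piecewise continuous functions with $|\varphi(z)|\le Ce^{\eta z}$). *)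

(* Defs.v *)
From HB Require Import structures.
From mathcomp Require Export all_boot all_order all_algebra.
From mathcomp Require Export all_classical all_reals all_analysis.
Export Order.TTheory GRing.Theory Num.Theory numFieldNormedType.Exports.

Set Implicit Arguments.
Unset Strict Implicit.
Unset Printing Implicit Defensive.

Local Open Scope classical_set_scope.
Local Open Scope ring_scope.

Section gamma_formulas.
Context {R : realType} (a b : R).
Local Notation mu := (@lebesgue_measure R).

Definition gamma_exponent (lambda : R) : R := a * ln (1 + lambda / b).

Definition Gamma_fun (s : R) : R :=
  \int[mu]_(u in `]0, +oo[) (u `^ (s - 1) * expR (- u)).

Definition gamma_density (t x : R) : R :=
  if 0 < x then
    b `^ (a * t) / Gamma_fun (a * t) * x `^ (a * t - 1) * expR (- (b * x))
  else 0.

(* Tail of the Levy measure a * exp (- b * z) / z dz of gamma_exponent. *)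
Definition levy_tail (y : R) : R :=
  a * \int[mu]_(z in `]y, +oo[) (expR (- (b * z)) / z).

Definition RL_operator (phi : R -> R) (x : R) : R :=
  derive1
    (fun z : R => \int[mu]_(y in `[0, z]) (phi (z - y) * levy_tail y)) x.

End gamma_formulas.

Section subordinators.
Context {d : measure_display} {T : measurableType d} {R : realType}
  (P : probability T R) (H : R -> {RV P >-> R}).

(* Only the times t >= 0 are constrained. *)

Definition independent_increments : Prop :=
  forall (n : nat) (t : nat -> R) (A : nat -> set R),
    0 <= t 0%N -> nondecreasing_seq t -> (forall i, measurable (A i)) ->
    P (\bigcap_(i in `I_n) [set w | A i (H (t i.+1) w - H (t i) w)]) =
    (\prod_(i < n) P [set w | A i (H (t i.+1) w - H (t i) w)%R])%E.

Definition stationary_increments : Prop :=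
  forall (s t : R) (A : set R), 0 <= s -> 0 <= t -> measurable A ->
    P [set w | A (H (s + t) w - H s w)] = P [set w | A (H t w)].

(* Left limits need not be required: they exist by monotonicity. *)
Definition subordinator_paths : Prop :=
  {ae P, forall w, [/\ H 0 w = 0,
    (forall s t : R, 0 <= s -> s <= t -> H s w <= H t w) &
    (forall t : R, 0 <= t -> H s w @[s --> t^'+] --> H t w)]}.

Definition subordinator : Prop :=
  [/\ independent_increments, stationary_increments & subordinator_paths].

Definition gamma_subordinator (a b : R) : Prop :=
  subordinator /\
  forall t lambda : R, 0 <= t -> 0 <= lambda ->
    ('E_P[(fun w => expR (- (lambda * H t w)))] =
     (expR (- (t * gamma_exponent a b lambda)))%:E)%E.

(* Extended-real valued: equal to +oo when H never leaves ]0, x[. *)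
Definition inverse_process (x : R) (w : T) : \bar R :=
  ereal_inf (EFin @` [set s : R | 0 < s /\ ~ `]0, x[%classic (H s w)]).

End subordinators.

Section function_spaces.
Context {R : realType}.
Local Notation mu := (@lebesgue_measure R).

Definition C1_pos (g : R -> R) : Prop :=
  forall z : R, 0 < z -> derivable g z 1 /\ {for z, continuous (derive1 g)}.

(* C^1_c (0, oo): the test functions used by Brezis to define W^{1,p} of an
   interval; C^oo_c test functions give the same space. *)
Definition test_function (phi : R -> R) : Prop :=
  [/\ (forall z : R, derivable phi z 1), continuous (derive1 phi) &
      exists l r : R, 0 < l /\ forall z : R, ~ (l <= z <= r) -> phi z = 0].

Definition L1_pos (g : R -> R) : Prop :=
  mu.-integrable `]0, +oo[ (EFin \o g).

Definition weak_derivative (psi g : R -> R) : Prop :=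
  forall phi : R -> R, test_function phi ->
    \int[mu]_(x in `]0, +oo[) (psi x * derive1 phi x) =
    - \int[mu]_(x in `]0, +oo[) (g x * phi x).

Definition W11 (psi : R -> R) : Prop :=
  L1_pos psi /\ exists2 g : R -> R, L1_pos g & weak_derivative psi g.

(* An element of W^{1,1}(0, oo) is identified with its representative that is
   continuous on [0, +oo[, so that the boundary value psi 0 makes sense. *)
Definition W11_0 (psi : R -> R) : Prop :=
  [/\ W11 psi, {within `[0, +oo[, continuous psi} & psi 0 = 0].

(* M_0 `&` C(0, oo). *)
Definition bounded_continuous_pos (g : R -> R) : Prop :=
  (forall z : R, 0 < z -> {for z, continuous g}) /\
  exists C : R, forall z : R, 0 < z -> `|g z| <= C.

Definition C11_W11_0 (v : R -> R -> R) : Prop :=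
  [/\ (forall t x : R, 0 < t -> 0 < x -> 0 <= v t x),
      (forall x : R, 0 < x -> C1_pos (v ^~ x)),
      (forall t : R, 0 < t -> C1_pos (v t)) &
      (forall t : R, 0 < t -> W11_0 (v t))].

Definition laplace_class (v : R -> R -> R) : Prop :=
  (forall x : R, 0 < x -> bounded_continuous_pos (v ^~ x)) /\
  (forall t : R, 0 < t -> bounded_continuous_pos (v t)).

(* The class only controls v at times t > 0, so the initial condition includes
   the continuity of v (., x) at t = 0; v 0 x = f x alone would put no
   constraint on the values at positive times. *)
Definition gamma_problem_solution (a b : R) (f : R -> R) (v : R -> R -> R)
    : Prop :=
  [/\ (forall t x : R, 0 < t -> 0 < x ->
         derive1 (v ^~ x) t = - RL_operator a b (v t) x),
      (forall x : R, 0 < x -> v 0 x = f x /\ v t x @[t --> 0^'+] --> v 0 x) &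
      (forall t x : R, 0 < t -> x <= 0 -> v t x = 0)].

End function_spaces.

(* Main.v *)
(* The Laplace transform in x turns the equation into
   d/dt lap l (v t) = - Phi l * lap l (v t), whose solution
   exp (- t Phi l) * lap l f is the transform of the convolution of f with the
   gamma density, and also of E[f (x - H t), t < L x], because L x > t holds
   almost surely exactly when H t < x. The difficulty is to differentiate
   under the integral in x: v is only separately regular, and no bound uniform
   in t is available. Let energy t be the sum of the L1 norms of v t and of
   d/dt v t. It is finite, because v t is in W^{1,1}_0 and
   d/dt v t = - (v t)' * tail with an integrable Levy tail, and it is lower
   semicontinuous by Fatou's lemma. On a time interval where it is bounded,
   Fubini's theorem gives the exponential law, and then energy is nonincreasing
   there. The law extends to the left end point al of such an interval: for s
   just above al, v s is a gamma density of positive shape convolved with a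
   fixed integrable function, hence converges in L1. A Baire category argument
   then shows that energy is locally bounded on ]0, +oo[, and the same
   extension argument at time 0 brings in the initial value. *)
Require Import Defs.
From mathcomp Require Import measurable_realfun ring lra.

Set Implicit Arguments.
Unset Strict Implicit.
Unset Printing Implicit Defensive.

Local Open Scope classical_set_scope.
Local Open Scope ring_scope.

(** * Integration, convolution and Laplace transforms *)

(** Injectivity of the Laplace transform yields equality almost everywhere only. It is therefore
    applied to the [x]-derivatives: [v t] and both right-hand sides are primitives of integrable
    functions, hence equal at every point. The energy contains the time derivative because Fubini is
    applied to the [r]-derivative of [expR (r * Phi l) * w r x]. Along the evolution [w] and its
    time derivative obey the same exponential law, so both [L1] norms are contracted by convolution
    with a probability density. The passage to a left end point [al] uses no regularity at [al],
    only regularity at a later time [t]. Indeed [1 + l / b = expR (Phi l / a)]: one derivative in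
    [x] is worth a time [1 / a] of the gamma semigroup. Going back from [t] by less than [1 / a]
    costs less than this gain, and a gamma density of positive shape remains. This is the origin of
    the condition [a * (t - al) < 1] and of the step [(2 * a)^-1]. *)

Section affine_change_of_variable.
Context {R : realType}.
Local Notation mu := (@lebesgue_measure R).
Variables (c d : R).
Hypothesis c_gt0 : 0 < c.

Let aff : measurableTypeR R -> measurableTypeR R := fun x => c * x + d.

Let measurable_aff : measurable_fun setT aff.
Proof. by apply: measurable_funD => //; apply: measurable_funM. Qed.

Let pushforward_aff : {measure set (measurableTypeR R) -> \bar R} :=
  measure_function_pushforward__canonical__measure_function_Measure mu measurable_aff.

Lemma lebesgue_measure_affine (A : set R) : measurable A ->
  mu A = mscale (NngNum (ltW c_gt0)) pushforward_aff A.
Proof.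
move=> mA; apply: lebesgue_measure_unique mA => _ [[x y]] _ <-.
transitivity (c%:E * mu (aff @^-1` `]x, y]))%E; last by [].
have -> : aff @^-1` `]x, y] = `](x - d) / c, (y - d) / c]%classic.
  apply/seteqP; split=> z; rewrite /aff /= !in_itv /= ltr_pdivrMr // ler_pdivlMr //
    ltrBlDr lerBrDr ![z * c]mulrC //.
rewrite !lebesgue_measure_itv /= !lte_fin ltr_pM2r ?invr_gt0 // ltrD2r.
case: ifPn => _; last by rewrite mule0.
by rewrite -EFinD -EFinM; congr _%:E; field; rewrite gt_eqF.
Qed.

Lemma ge0_integral_affine (f : R -> \bar R) :
  measurable_fun [set: R] f -> (forall x, 0 <= f x)%E ->
  (\int[mu]_x f x = c%:E * \int[mu]_x f (c * x + d)%R)%E.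
Proof.
move=> mf f0.
rewrite (eq_measure_integral (mscale (NngNum (ltW c_gt0)) pushforward_aff)); last first.
  by move=> A mA _; exact: lebesgue_measure_affine.
rewrite ge0_integral_mscale //=; congr (_ * _)%E.
by rewrite ge0_integral_pushforward.
Qed.

Lemma integral_affine (f : R -> \bar R) : measurable_fun [set: R] f ->
  (\int[mu]_x f x = c%:E * \int[mu]_x f (c * x + d)%R)%E.
Proof.
move=> mf.
(* No integrability of [f] is assumed, so distributivity has to cover infinite positive and negative
   parts, including [+oo - +oo]. *)
have cB (A B : \bar R) : (0 <= A -> 0 <= B -> c%:E * (A - B) = c%:E * A - c%:E * B)%E.
  case: A => [r1| |] // _; case: B => [r2| |] // _.
  - by rewrite -EFinB -!EFinM mulrBr EFinB.
  - by rewrite /= !gt0_muley ?lte_fin //= gt0_muleNy ?lte_fin.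
  - by rewrite /= !gt0_muley ?lte_fin //=.
  - by rewrite /= !gt0_muley ?lte_fin //= gt0_muleNy ?lte_fin.
pose g x := f (c * x + d)%R.
have gp : g^\+%E = (fun x => f^\+ (c * x + d)%R)%E.
  exact: (funepos_comp f (fun x => c * x + d)).
have gm : g^\-%E = (fun x => f^\- (c * x + d)%R)%E.
  exact: (funeneg_comp f (fun x => c * x + d)).
rewrite -[in RHS]/g [LHS]integralE [in RHS]integralE gp gm cB; last 2 first.
- by apply: integral_ge0 => x _; exact: funepos_ge0.
- by apply: integral_ge0 => x _; exact: funeneg_ge0.
by congr (_ - _)%E; apply: ge0_integral_affine => //;
  [exact: measurable_funepos|exact: measurable_funeneg].
Qed.

End affine_change_of_variable.

(** * Real-valued integrals and Fubini's theorem *)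

Section Rintegral_complements.
Context {d : measure_display} {T : measurableType d} {R : realType}.
Variable mu : {measure set T -> \bar R}.

(** A finite integral of a measurable function forces integrability, and [fine] sends the infinite
    values to 0. This default value is what frees [Rintegral_scale] from an integrability
    hypothesis. *)
Lemma Rintegral_not_integrable (D : set T) (f : T -> R) : measurable D ->
  measurable_fun D f -> ~ mu.-integrable D (EFin \o f) ->
  \int[mu]_(x in D) f x = 0.
Proof.
move=> mD mf nf; rewrite /Rintegral.
have mF : measurable_fun D (EFin \o f) by exact/measurable_EFinP.
have [fin|/negP nfin] := boolP ((\int[mu]_(x in D) (f x)%:E)%E \is a fin_num).
  exfalso; apply: nf; apply/integrableP; split=> //.
  by rewrite (integral_fin_num_abs mu mD mf).
by move: nfin; case: (\int[mu]_(x in D) (f x)%:E)%E.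
Qed.

Lemma Rintegral_scale (D : set T) (f : T -> R) (c : R) : measurable D ->
  measurable_fun D f -> \int[mu]_(x in D) (c * f x) = c * \int[mu]_(x in D) f x.
Proof.
move=> mD mf; have [->|c0] := eqVneq c 0.
  by rewrite mul0r; under eq_Rintegral do rewrite mul0r; rewrite Rintegral_cst // mul0r.
have [fi|nfi] := pselect (mu.-integrable D (EFin \o f)).
  exact: RintegralZl.
rewrite (Rintegral_not_integrable mD mf nfi) mulr0 Rintegral_not_integrable //.
  exact: measurable_funM.
move=> cfi; apply: nfi.
have := integrableZl mD c^-1 cfi.
apply: eq_integrable => // x _ /=.
by rewrite -EFinM mulrA mulVf // mul1r.
Qed.

End Rintegral_complements.

Section real_integrals.
Context {d : measure_display} {T : measurableType d} {R : realType}.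
Variable mu : {measure set T -> \bar R}.
Local Notation L1 k := (mu.-integrable [set: T] (EFin \o k)).

Lemma ae_impl (P Q : T -> Prop) : {ae mu, forall x, P x} ->
  (forall x, P x -> Q x) -> {ae mu, forall x, Q x}.
Proof. by move=> aP PQ; apply: filterS aP. Qed.

Lemma ae_impl2 (P P' Q : T -> Prop) : {ae mu, forall x, P x} -> {ae mu, forall x, P' x} ->
  (forall x, P x -> P' x -> Q x) -> {ae mu, forall x, Q x}.
Proof. by move=> aP aP' PQ; apply: filterS2 aP aP'. Qed.

Lemma L1_measurable (k : T -> R) : L1 k -> measurable_fun [set: T] k.
Proof. by move=> /measurable_int /measurable_EFinP. Qed.

Lemma L1_le (h k : T -> R) : measurable_fun [set: T] k ->
  (forall x, `|k x| <= h x) -> L1 h -> L1 k.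
Proof.
move=> mk kh; apply: le_integrable => //; first exact/measurable_EFinP.
by move=> x _ /=; rewrite lee_fin (le_trans (kh x)) // ler_norm.
Qed.

Lemma L1_restrict (D : set T) (k : T -> R) : measurable D ->
  mu.-integrable D (EFin \o k) -> L1 (k \_ D).
Proof.
by move=> mD /(integrable_mkcond (EFin \o k) mD); rewrite restrict_EFin.
Qed.

Lemma L1Z (c : R) (k : T -> R) : L1 k -> L1 (fun x => c * k x).
Proof.
by move=> ik; have := integrableZl measurableT c ik; apply: eq_integrable.
Qed.

Lemma L1D (h k : T -> R) : L1 h -> L1 k -> L1 (fun x => h x + k x).
Proof.
by move=> ih ik; have := integrableD measurableT ih ik; apply: eq_integrable.
Qed.

Lemma L1B (h k : T -> R) : L1 h -> L1 k -> L1 (fun x => h x - k x).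
Proof.
by move=> ih ik; have := integrableB measurableT ih ik; apply: eq_integrable.
Qed.

Lemma L1_norm (k : T -> R) : L1 k -> L1 (fun x => `|k x|).
Proof.
by move=> ik; have := integrable_norm ik; apply: eq_integrable.
Qed.

Lemma EFin_Rintegral (k : T -> R) : L1 k ->
  (\int[mu]_x k x)%:E = (\int[mu]_x (k x)%:E)%E.
Proof. by move=> ik; rewrite /Rintegral fineK //; exact: integrable_fin_num. Qed.

Lemma ae_eq_Rintegral (h k : T -> R) : measurable_fun [set: T] h ->
  measurable_fun [set: T] k -> {ae mu, forall x, h x = k x} ->
  \int[mu]_x h x = \int[mu]_x k x.
Proof.
move=> mh mk hk; congr fine; apply: ae_eq_integral => //; try exact/measurable_EFinP.
by apply: filterS hk => x /= -> _.
Qed.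

Lemma L1_ae_eq (h k : T -> R) : L1 h -> measurable_fun [set: T] k ->
  {ae mu, forall x, h x = k x} -> L1 k.
Proof.
move=> ih mk hk; apply/integrableP; split; first exact/measurable_EFinP.
move/integrableP: (ih) => [mh]; apply: le_lt_trans.
rewrite le_eqVlt; apply/orP; left; apply/eqP.
apply: ae_eq_integral => //; try exact: measurableT_comp.
  by apply: measurableT_comp => //; exact/measurable_EFinP.
by apply: filterS hk => x /= -> _.
Qed.

Lemma Rdominated_cvg (f_ : nat -> T -> R) (f g : T -> R) :
  (forall n, measurable_fun [set: T] (f_ n)) -> measurable_fun [set: T] f ->
  {ae mu, forall x, f_ n x @[n --> \oo] --> f x} -> L1 g ->
  (forall n x, `|f_ n x| <= g x) ->
  \int[mu]_x f_ n x @[n --> \oo] --> \int[mu]_x f x.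
Proof.
move=> mf_ mf ff ig fg.
have if_ n : L1 (f_ n) by exact: (L1_le (mf_ n) (fg n) ig).
have mF (k : T -> R) : measurable_fun [set: T] k -> measurable_fun [set: T] (EFin \o k).
  by move=> mk; exact/measurable_EFinP.
have ff' : {ae mu, forall x, [set: T] x -> (f_ n x)%:E @[n --> \oo] --> (f x)%:E}.
  by apply: filterS ff => x fx _; apply: cvg_EFin; [exact: nearW|exact: fx].
have fg' : {ae mu, forall x n, [set: T] x -> (`|(f_ n x)%:E| <= (g x)%:E)%E}.
  by apply: aeW => x n _ /=; rewrite lee_fin.
have [if' _ lim] := dominated_convergence measurableT (fun n => mF _ (mf_ n)) (mF _ mf)
  ff' ig fg'.
by apply: fine_cvg; rewrite EFin_Rintegral.
Qed.

End real_integrals.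

Notation L1 mu k := (mu.-integrable setT (EFin \o k)).

Section real_fubini.
Context {d1 d2 : measure_display} {T1 : measurableType d1} {T2 : measurableType d2}.
Context {R : realType}.
Variables (m1 : {sigma_finite_measure set T1 -> \bar R})
  (m2 : {sigma_finite_measure set T2 -> \bar R}).
Variable F : T1 * T2 -> R.
Hypothesis iF : L1 (m1 \x m2)%E F.

(** The sections of [F] are integrable for almost every [x] only, so passing to the reals through
    [fine] can be undone only almost everywhere. *)
Lemma Rfubini_F_ae :
  {ae m1, forall x, (\int[m2]_y F (x, y))%:E = (\int[m2]_y (F (x, y))%:E)%E}.
Proof.
by apply: filterS (ae_integrable1 iF) => x ix; rewrite EFin_Rintegral.
Qed.

Lemma Rfubini_F_measurable : measurable_fun [set: T1] (fun x => \int[m2]_y F (x, y)).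
Proof.
apply: (@measurableT_comp _ _ _ _ _ _ (@fine R)); first exact: fine_measurable.
exact: measurable_int (integrable_fubini_F iF).
Qed.

Lemma Rfubini_F_L1 : L1 m1 (fun x => \int[m2]_y F (x, y)).
Proof.
have iFF := integrable_fubini_F iF.
apply/integrableP; split; first exact/measurable_EFinP/Rfubini_F_measurable.
move/integrableP: (iFF) => [mF]; apply: le_lt_trans.
rewrite le_eqVlt; apply/orP; left; apply/eqP.
apply: ae_eq_integral => //; try exact: measurableT_comp.
  by apply: measurableT_comp => //; exact/measurable_EFinP/Rfubini_F_measurable.
by apply: filterS Rfubini_F_ae => x h _; rewrite /= /fubini_F -h.
Qed.

Lemma Rfubini_FE : \int[m1]_x \int[m2]_y F (x, y) = \int[(m1 \x m2)%E]_z F z.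
Proof.
have iFF := integrable_fubini_F iF.
rewrite [RHS]/Rintegral -(integral12_prod_meas1 iF); congr fine.
apply: ae_eq_integral => //.
- exact/measurable_EFinP/Rfubini_F_measurable.
- exact: measurable_int iFF.
- by apply: filterS Rfubini_F_ae => x h _; rewrite /= /fubini_F -h.
Qed.

End real_fubini.

Section real_fubini_swap.
Context {d1 d2 : measure_display} {T1 : measurableType d1} {T2 : measurableType d2}.
Context {R : realType}.
Variables (m1 : {sigma_finite_measure set T1 -> \bar R})
  (m2 : {sigma_finite_measure set T2 -> \bar R}).
Variable F : T1 * T2 -> R.

Hypothesis iF : L1 (m1 \x m2)%E F.

Lemma L1_swap : L1 (m2 \x m1)%E (fun z => F (z.2, z.1)).
Proof.
have mF : measurable_fun setT (EFin \o F) := measurable_int _ iF.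
have mF' : measurable_fun setT (EFin \o (fun z : T2 * T1 => F (z.2, z.1))).
  apply/measurable_EFinP; apply: (@measurableT_comp _ _ _ _ _ _ F).
    exact/measurable_EFinP.
  exact: measurable_swap.
apply/integrable12ltyP => //=; have := (integrable21ltyP m1 m2 mF).1 iF.
exact: id.
Qed.

Lemma Rfubini : \int[m1]_x \int[m2]_y F (x, y) = \int[m2]_y \int[m1]_x F (x, y).
Proof.
have iFF := integrable_fubini_F L1_swap.
rewrite (Rfubini_FE iF) [LHS]/Rintegral.
transitivity (fine (\int[m2]_y \int[m1]_x (F (x, y))%:E)%E).
  by congr fine; rewrite -(integral21_prod_meas1 iF).
congr fine; apply: ae_eq_integral => //.
- exact: measurable_int iFF.
- exact/measurable_EFinP/(Rfubini_F_measurable L1_swap).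
- by apply: filterS (Rfubini_F_ae L1_swap) => x /= h _; rewrite -h.
Qed.

End real_fubini_swap.

(** * Convolution on the line *)

Section convolution.
Context {R : realType}.
Local Notation mu := (@lebesgue_measure R).
Implicit Types f h k : R -> R.

Lemma measurable_shift f c : measurable_fun [set: R] f ->
  measurable_fun [set: R] (fun x => f (x - c)).
Proof.
move=> mf; apply: (measurableT_comp mf).
by apply: measurable_funB.
Qed.

Lemma integral_shift (F : R -> \bar R) c : measurable_fun [set: R] F ->
  (\int[mu]_x F (x - c)%R = \int[mu]_x F x)%E.
Proof.
move=> mF; rewrite [RHS](@integral_affine _ 1 (- c)) // mul1e.
by apply: eq_integral => x _; rewrite mul1r.
Qed.

Lemma Rintegral_shift f c : measurable_fun [set: R] f ->
  \int[mu]_x f (x - c) = \int[mu]_x f x.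
Proof.
move=> mf; congr fine; rewrite (@integral_shift (EFin \o f)) //.
exact/measurable_EFinP.
Qed.

Lemma measurable_conv_kernel f h : measurable_fun [set: R] f ->
  measurable_fun [set: R] h ->
  measurable_fun setT (fun z : R * R => f (z.1 - z.2) * h z.2).
Proof.
move=> mf mh; apply: measurable_funM.
  apply: (measurableT_comp mf); apply: measurable_funB;
    [exact: measurable_fst|exact: measurable_snd].
by apply: (measurableT_comp mh); exact: measurable_snd.
Qed.

Lemma L1_conv_kernel f h : L1 mu f -> L1 mu h ->
  L1 (mu \x mu)%E (fun z : R * R => f (z.1 - z.2) * h z.2).
Proof.
move=> fi hi; have mf := L1_measurable fi; have mh := L1_measurable hi.
have mk := measurable_conv_kernel mf mh.
apply/integrable21ltyP; first exact/measurable_EFinP.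
rewrite /=.
under eq_integral => y _.
  under eq_integral => x _ do rewrite normrM EFinM muleC.
  rewrite ge0_integralZl //; last first.
    by apply/measurable_EFinP; apply: measurableT_comp => //; exact: measurable_shift.
  rewrite (@integral_shift (fun x => `|(f x)%:E|%E)) //; last first.
    by apply: measurableT_comp => //; exact/measurable_EFinP.
  over.
rewrite /=.
move/integrableP: (fi) => [_ /= ffin].
move/integrableP: (hi) => [_ /= hfin].
rewrite ge0_integralZr //; last 2 first.
- by apply/measurable_EFinP; apply: measurableT_comp.
- by apply: integral_ge0.
apply: lte_mul_pinfty => //; first exact: integral_ge0.
by rewrite ge0_fin_numE //; exact: integral_ge0.
Qed.

Definition conv f h x := \int[mu]_y (f (x - y) * h y).

Lemma L1_conv f h : L1 mu f -> L1 mu h -> L1 mu (conv f h).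
Proof. by move=> fi hi; exact: Rfubini_F_L1 (L1_conv_kernel fi hi). Qed.

Lemma Rintegral_conv f h : L1 mu f -> L1 mu h ->
  \int[mu]_x conv f h x = (\int[mu]_x f x) * (\int[mu]_x h x).
Proof.
move=> fi hi; have mf := L1_measurable fi; have mh := L1_measurable hi.
rewrite (Rfubini (L1_conv_kernel fi hi)) /=.
under eq_Rintegral => y _.
  under eq_Rintegral => x _ do rewrite mulrC.
  rewrite Rintegral_scale //; last exact: measurable_shift.
  rewrite Rintegral_shift //.
  rewrite mulrC; over.
by rewrite /= Rintegral_scale.
Qed.

Lemma Rintegral_norm_conv f h : L1 mu f -> L1 mu h ->
  \int[mu]_x `|conv f h x| <= (\int[mu]_x `|f x|) * (\int[mu]_x `|h x|).
Proof.
move=> fi hi; have mf := L1_measurable fi; have mh := L1_measurable hi.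
have ki' := L1_conv_kernel (L1_norm fi) (L1_norm hi).
rewrite -Rintegral_conv; [|exact: L1_norm..].
apply: le_Rintegral => //; [exact/L1_norm/L1_conv|by apply: L1_conv; exact: L1_norm|].
move=> x _; have mx : measurable_fun [set: R] (fun y => f (x - y) * h y).
  by apply: measurable_funM => //; apply: (measurableT_comp mf); exact: measurable_funB.
have nE : (fun y => `|f (x - y)| * `|h y|) = (fun y => `|f (x - y) * h y|).
  by apply/funext => y; rewrite normrM.
rewrite {2}/conv nE; have [xi|xni] := pselect (L1 mu (fun y => f (x - y) * h y)).
  exact: le_normr_Rintegral.
(* Where the kernel is not integrable, [conv f h x] takes the default value 0. *)
by rewrite /conv Rintegral_not_integrable // normr0 Rintegral_ge0.
Qed.

End convolution.

(** * The Laplace transform and its injectivity *)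

Section laplace.
Context {R : realType}.
Local Notation mu := (@lebesgue_measure R).
Implicit Types f h k : R -> R.

(** Taken over the whole line; with [pos_supp] it is the one-sided transform, and translations and
    convolutions then require no cut-off. *)
Definition lap (l : R) k := \int[mu]_x (expR (- (l * x)) * k x).

Definition pos_supp k := forall x, x <= 0 -> k x = 0.

Lemma measurable_exp (l : R) : measurable_fun [set: R] (fun x => expR (- (l * x))).
Proof.
apply: continuous_measurable_fun => x.
by apply: continuous_comp; [apply: continuousN; exact: mulrl_continuous|exact: continuous_expR].
Qed.

Lemma L1_exp l k : 0 <= l -> L1 mu k -> pos_supp k ->
  L1 mu (fun x => expR (- (l * x)) * k x).
Proof.
move=> l0 ik sk; apply: L1_le (L1_norm ik).
  by apply: measurable_funM; [exact: measurable_exp|exact: L1_measurable ik].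
move=> x; rewrite normrM; have [x0|x0] := leP x 0; first by rewrite sk // normr0 mulr0.
rewrite ger0_norm ?expR_ge0 // ler_piMl // -expR0 ler_expR oppr_le0.
by rewrite mulr_ge0 // ltW.
Qed.

Lemma pos_supp_conv f h : pos_supp f -> pos_supp h -> pos_supp (conv f h).
Proof.
move=> sf sh x x0; rewrite /conv; under eq_Rintegral => y _.
  have -> : f (x - y) * h y = 0.
    have [y0|y0] := leP y 0; first by rewrite sh // mulr0.
    by rewrite sf ?mul0r // subr_le0 (le_trans x0) // ltW.
  over.
by rewrite Rintegral_cst // mul0r.
Qed.

Lemma lap_conv l f h : 0 <= l -> L1 mu f -> L1 mu h -> pos_supp f -> pos_supp h ->
  lap l (conv f h) = lap l f * lap l h.
Proof.
move=> l0 fi hi sf sh.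
have mf := L1_measurable fi; have mh := L1_measurable hi.
rewrite -Rintegral_conv; [|exact: L1_exp..].
apply: eq_Rintegral => x _; rewrite /conv -Rintegral_scale //; last first.
  by apply: measurable_funM => //; apply: (measurableT_comp mf); exact: measurable_funB.
apply: eq_Rintegral => y _.
rewrite [RHS]mulrACA -expRD; congr (expR _ * _); ring.
Qed.

Lemma lapB l f h : 0 <= l -> L1 mu f -> L1 mu h -> pos_supp f -> pos_supp h ->
  lap l (fun x => f x - h x) = lap l f - lap l h.
Proof.
move=> l0 fi hi sf sh; rewrite /lap -RintegralB //; try exact: L1_exp.
by apply: eq_Rintegral => x _; rewrite mulrBr.
Qed.

Lemma lapD l f h : 0 <= l -> L1 mu f -> L1 mu h -> pos_supp f -> pos_supp h ->
  lap l (fun x => f x + h x) = lap l f + lap l h.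
Proof.
move=> l0 fi hi sf sh; rewrite /lap -RintegralD //; try exact: L1_exp.
by apply: eq_Rintegral => x _; rewrite mulrDr.
Qed.

Lemma lapZ l c f : L1 mu f -> lap l (fun x => c * f x) = c * lap l f.
Proof.
move=> fi; rewrite /lap -Rintegral_scale //.
  by apply: eq_Rintegral => x _; rewrite mulrCA.
by apply: measurable_funM; [exact: measurable_exp|exact: L1_measurable fi].
Qed.

Lemma lap_ae_eq l f h : measurable_fun [set: R] f -> measurable_fun [set: R] h ->
  {ae mu, forall x, f x = h x} -> lap l f = lap l h.
Proof.
move=> mf mh fh; apply: ae_eq_Rintegral.
- by apply: measurable_funM => //; exact: measurable_exp.
- by apply: measurable_funM => //; exact: measurable_exp.
- by apply: ae_impl fh _ => x ->.
Qed.

Definition prim k (x : R) := \int[mu]_(y in `]-oo, x]) k y.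

Lemma L1_locally_integrable k : L1 mu k -> locally_integrable [set: R] k.
Proof.
move=> ik; have := integrable_locally_restrict measurableT ik.
by rewrite patch_setT.
Qed.

Lemma prim_derive1 k : L1 mu k ->
  {ae mu, forall x, derivable (prim k) x 1 /\ derive1 (prim k) x = k x}.
Proof.
move=> ik; apply: FTC1Ny; last exact: L1_locally_integrable.
by move=> y; apply: integrableS ik.
Qed.

Lemma primE k x : prim k x = \int[mu]_y (k y * \1_`]-oo, x] y).
Proof.
rewrite /prim Rintegral_mkcond; apply: eq_Rintegral => y _.
by rewrite patchE indicE; case: ifPn => _; rewrite ?mulr1 ?mulr0.
Qed.

(* With [u = expR (- (ln 2 / c * x))], so that [u < 1 / 2] means [c < x], this is
   the behaviour of [(1 - u ^+ n) ^+ (2 ^ n)], a combination of the exponentials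
   [u ^+ k]: it tends to the indicator of [u < 1 / 2]. *)
Lemma cvg_one_minus_pow (x c : R) : 0 < c -> 0 < x -> x != c ->
  1 - (1 - expR (- (n%:R * (ln 2 / c) * x))) ^+ (2 ^ n) @[n --> \oo] -->
  ((x <= c)%R%:R : R).
Proof.
move=> c0 x0 xc; set dl := ln 2 / c.
have dl0 : 0 < dl by rewrite divr_gt0 // ln_gt0 // ltr1n.
(* [q] is [expR (dl * (c - x))], so [q > 1] exactly when [x < c]. With
   [y = expR (- (n%:R * dl * x))] one has [2 ^ n * y = q ^ n], and the bounds
   [(1 - y) ^ N <= expR (- (N * y))] and [1 - (1 - y) ^ N <= N * y] at [N = 2 ^ n] settle the two
   cases. *)
pose q := 2 * expR (- (dl * x)).
have q0 : 0 < q by rewrite mulr_gt0 ?expR_gt0.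
have qn n : (2 ^ n)%:R * expR (- (n%:R * dl * x)) = q ^+ n.
  rewrite /q exprMn natrX -expRM_natl; congr (_ * expR _); ring.
have y01 n : 0 <= expR (- (n%:R * dl * x)) <= 1.
  by rewrite expR_ge0 /= -expR0 ler_expR oppr_le0 mulr_ge0 ?(ltW x0) // mulr_ge0 // ltW.
have two : 2 = expR (dl * c) :> R by rewrite /dl divfK ?gt_eqF // lnK // posrE.
have [xltc|cx|/eqP] := ltgtP x c; last by rewrite (negbTE xc).
- have q1 : 1 < q.
    by rewrite /q {1}two -expRD expR_gt1 -mulrBr mulr_gt0 // subr_gt0.
  rewrite -[true%:R]/(1 : R) -[X in _ --> X](subr0 (1 : R)); apply: cvgB; first exact: cvg_cst.
  apply: (@squeeze_cvgr _ _ _ _ (cst 0) (fun n => q^-1 ^+ n)); last 2 first.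
  + exact: cvg_cst.
  + by apply: cvg_expr; rewrite gtr0_norm ?invr_gt0 // invf_lt1.
  apply: nearW => n; have /andP[y0 y1] := y01 n.
  rewrite exprn_ge0 ?subr_ge0 //=.
  apply: (@le_trans _ _ (expR (- (q ^+ n)))).
    rewrite -qn; set y := expR (- (_ * x)) in y0 y1 *.
    rewrite -mulrN expRM_natl lerXn2r ?nnegrE ?subr_ge0 ?expR_ge0 //.
    exact: expR_ge1Dx.
  rewrite expRN exprVn lef_pV2 ?posrE ?expR_gt0 ?exprn_gt0 //.
  by apply: le_trans (expR_ge1Dx _); rewrite lerDr.
- have q1 : q < 1.
    by rewrite /q {1}two -expRD -expR0 ltr_expR -mulrBr pmulr_rlt0 // subr_lt0.
  apply: (@squeeze_cvgr _ _ _ _ (cst 0) (fun n => q ^+ n)); last 2 first.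
  + exact: cvg_cst.
  + by apply: cvg_expr; rewrite gtr0_norm.
  apply: nearW => n; have /andP[y0 y1] := y01 n.
  rewrite subr_ge0 exprn_ile1 ?subr_ge0 ?gerBl //=.
  rewrite -qn; set y := expR _ in y0 y1 *; elim: (2 ^ n)%N => [|m IH].
    by rewrite expr0 subrr mul0r.
  rewrite exprS -natr1 mulrDl mul1r.
  have : 0 <= (1 - y) ^+ m <= 1 by rewrite exprn_ge0 ?exprn_ile1 ?subr_ge0 ?gerBl.
  by move/andP=> [? ?]; nra.
Qed.

(** Polynomials without constant term in [expR (- (e * x))] integrate to 0 against [k]. Those of
    [cvg_one_minus_pow] converge boundedly to the indicator of []0, c]], so every [prim k c]
    vanishes, and Lebesgue differentiation recovers [k]. *)
Lemma lerch0 k : L1 mu k -> pos_supp k -> (forall l, 0 < l -> lap l k = 0) ->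
  {ae mu, forall x, k x = 0}.
Proof.
move=> ik sk lk; have mk := L1_measurable ik.
(* Induction on [N] with [y ^ m.+1 * (1 - y) ^ N.+1 = y ^ m.+1 * (1 - y) ^ N - y ^ m.+2 * (1 - y) ^
   N]. The exponent [m.+1] excludes the constant term, since the transform is only known to vanish
   at [l > 0]. *)
have mom e N m : 0 < e -> \int[mu]_x ((expR (- (e * x)) ^+ m.+1 * (1 - expR (- (e * x))) ^+ N)
  * k x) = 0.
  move=> e0; elim: N m => [|N IH] m.
    rewrite -[RHS](lk (m.+1%:R * e)) ?mulr_gt0 //; apply: eq_Rintegral => x _.
    by rewrite expr0 mulr1 -expRM_natl; congr (expR _ * _); ring.
  have Li j : L1 mu (fun x => (expR (- (e * x)) ^+ j * (1 - expR (- (e * x))) ^+ N) * k x).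
    apply: L1_le (L1_norm ik).
      apply: measurable_funM => //; apply: measurable_funM.
        by apply: measurable_funX; exact: measurable_exp.
      by apply: measurable_funX; apply: measurable_funB => //; exact: measurable_exp.
    move=> x; have [x0|x0] := leP x 0; first by rewrite sk // mulr0.
    rewrite normrM ler_piMl // ger0_norm.
      rewrite mulr_ile1 ?exprn_ge0 ?exprn_ile1 ?expR_ge0 ?subr_ge0 ?gerBl ?expR_ge0 //.
      + by rewrite -expR0 ler_expR oppr_le0 mulr_ge0 // ltW.
      + by rewrite -expR0 ler_expR oppr_le0 mulr_ge0 // ltW.
      + by rewrite -expR0 ler_expR oppr_le0 mulr_ge0 // ltW.
    rewrite mulr_ge0 ?exprn_ge0 ?expR_ge0 ?subr_ge0 //.
    by rewrite -expR0 ler_expR oppr_le0 mulr_ge0 // ltW.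
  rewrite -[RHS]subr0 -{1}(IH m) -(IH m.+1) -RintegralB //.
  by apply: eq_Rintegral => x _; set y := expR _; rewrite !exprS; ring.
pose u e (x : R) := expR (- (e * x)).
have mu_ e : measurable_fun [set: R] (u e) by exact: measurable_exp.
have u01 e x : 0 < e -> 0 < x -> 0 <= u e x <= 1.
  by move=> e0 x0; rewrite expR_ge0 /= -expR0 ler_expR oppr_le0 mulr_ge0 // ltW.
have mF e N : measurable_fun [set: R] (fun x => (1 - (1 - u e x) ^+ N) * k x).
  apply: measurable_funM => //; apply: measurable_funB => //.
  by apply: measurable_funX; apply: measurable_funB.
have Fk e N x : 0 < e -> `|(1 - (1 - u e x) ^+ N) * k x| <= `|k x|.
  move=> e0; have [x0|x0] := leP x 0; first by rewrite sk // mulr0.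
  have /andP[y0 y1] := u01 _ _ e0 x0.
  rewrite normrM ler_piMl // ger0_norm ?gerBl ?exprn_ge0 ?subr_ge0 //.
  by rewrite exprn_ile1 // ?subr_ge0 // gerBl.
have mF0 e N : 0 < e -> \int[mu]_x ((1 - (1 - u e x) ^+ N) * k x) = 0.
  move=> e0; elim: N => [|N IH].
    under eq_Rintegral do rewrite expr0 subrr mul0r.
    by rewrite Rintegral_cst // mul0r.
  have Li : L1 mu (fun x => (u e x ^+ 1 * (1 - u e x) ^+ N) * k x).
    apply: L1_le (L1_norm ik).
      apply: measurable_funM => //; apply: measurable_funM.
        by apply: measurable_funX; exact: mu_.
      by apply: measurable_funX; apply: measurable_funB => //; exact: mu_.
    move=> x; have [x0|x0] := leP x 0; first by rewrite sk // mulr0.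
    have /andP[y0 y1] := u01 _ _ e0 x0.
    rewrite normrM ler_piMl // ger0_norm ?mulr_ge0 ?exprn_ge0 ?subr_ge0 //.
    by rewrite mulr_ile1 ?exprn_ge0 ?exprn_ile1 ?subr_ge0 ?gerBl.
  have Lj : L1 mu (fun x => (1 - (1 - u e x) ^+ N) * k x).
    by apply: L1_le (L1_norm ik); [exact: mF|move=> x; exact: Fk].
  rewrite -[RHS]addr0 -{1}IH -(mom e N 0%N e0) -RintegralD //.
  by apply: eq_Rintegral => x _; rewrite /u; set y := expR _; rewrite !exprS expr0; ring.
have prim0 c : prim k c = 0.
  have [c0|c0] := leP c 0.
    rewrite primE -[RHS](mul0r (fine (mu setT))) -Rintegral_cst //.
    apply: eq_Rintegral => x _; rewrite indicE.
    have [xc|/ltW xc] := leP x c; first by rewrite sk ?mul0r // (le_trans xc).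
    have [->|xc'] := eqVneq x c; first by rewrite sk ?mul0r.
    by rewrite memNset ?mulr0 //= in_itv /= => /(conj xc)/andP/le_anti/eqP;
      rewrite eq_sym (negbTE xc').
  rewrite primE.
  pose sq n := \int[mu]_x ((1 - (1 - u (n.+1%:R * (ln 2 / c)) x) ^+ (2 ^ n.+1)) * k x).
  have sq0 : sq = cst 0.
    by apply/funext => n; rewrite /sq mF0 // mulr_gt0 // divr_gt0 // ln_gt0 // ltr1n.
  have sqc : sq n @[n --> \oo] --> \int[mu]_y (k y * \1_`]-oo, c] y).
    pose F n x := (1 - (1 - u (n.+1%:R * (ln 2 / c)) x) ^+ (2 ^ n.+1)) * k x.
    apply: (@Rdominated_cvg _ _ _ mu F _ (fun x => `|k x|)) => //.
    - by move=> n; exact: mF.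
    - by apply: measurable_funM => //; exact: measurable_indic.
    (* At [x = c] the approximants tend to [1 - expR (-1)], which is not the value of the indicator;
       this single point is null. *)
    - have cN : {ae mu, forall x, x != c}.
        exists [set c]; split; [exact: measurable_set1|exact: lebesgue_measure_set1|].
        by move=> x /= /negP; rewrite negbK => /eqP.
      apply: ae_impl cN _ => x xc; have [x0|x0] := leP x 0.
        rewrite sk // mul0r (_ : F ^~ x = cst 0); first exact: cvg_cst.
        by apply/funext => n; rewrite /F sk // mulr0.
      have -> : \1_`]-oo, c] x = (x <= c)%R%:R :> R.
        by rewrite indicE; congr (nat_of_bool _)%:R; apply/idP/idP; rewrite inE /= in_itv.
      have := cvg_one_minus_pow c0 x0 xc.
      rewrite -(cvg_shiftS (fun n => 1 - (1 - expR (- (n%:R * (ln 2 / c) * x))) ^+ (2 ^ n))).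
      by move=> xlim; rewrite [k x * _]mulrC; apply: (cvgM xlim (cvg_cst (k x))).
    - exact: L1_norm.
    - by move=> n x; apply: Fk; rewrite mulr_gt0 // divr_gt0 // ln_gt0 // ltr1n.
  by move/cvg_lim : sqc => <- //; rewrite sq0 lim_cst.
have primk0 : prim k = cst 0 by apply/funext => x; rewrite prim0.
by apply: ae_impl (prim_derive1 ik) _ => x [_ <-]; rewrite primk0 derive1_cst.
Qed.

Lemma lerch f h : L1 mu f -> L1 mu h -> pos_supp f -> pos_supp h ->
  (forall l, 0 < l -> lap l f = lap l h) -> {ae mu, forall x, f x = h x}.
Proof.
move=> fi hi sf sh fh; have := @lerch0 (fun x => f x - h x) (L1B fi hi).
have sfh : pos_supp (fun x => f x - h x) by move=> x x0; rewrite sf // sh // subrr.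
move=> /(_ sfh) fh0; apply: ae_impl (fh0 _) _ => [l l0|x /eqP].
  by rewrite lapB ?fh ?subrr // ltW.
by rewrite subr_eq0 => /eqP.
Qed.

End laplace.

(** * Gamma densities *)

Section gamma.
Context {R : realType}.
Local Notation mu := (@lebesgue_measure R).

Lemma FTC2_is_derive (f F : R -> R) (a b : R) : a < b ->
  (forall x : R, a <= x <= b -> {for x, continuous f}) ->
  (forall x : R, a <= x <= b -> is_derive x 1 F (f x)) ->
  (\int[mu]_(x in `[a, b]) (f x)%:E = (F b - F a)%:E)%E.
Proof.
move=> ab cf dF.
have cF x : a <= x <= b -> {for x, continuous F}.
  move=> /dF df; apply: differentiable_continuous; apply/derivable1_diffP; exact: ex_derive.
rewrite (@continuous_FTC2 _ f F) //.
- apply: continuous_in_subspaceT => x; rewrite inE /= in_itv /=; exact: cf.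
- split.
  + move=> x; rewrite in_itv /= => /andP[ax xb].
    have df : is_derive x 1 F (f x) by apply: dF; rewrite !ltW.
    exact: ex_derive.
  + by apply: cvg_at_right_filter; apply: cF; rewrite lexx ltW.
  + by apply: cvg_at_left_filter; apply: cF; rewrite lexx ltW.
- move=> x; rewrite in_itv /= => /andP[ax xb].
  have df : is_derive x 1 F (f x) by apply: dF; rewrite !ltW.
  by rewrite derive1E derive_val.
Qed.

(** A bounded antiderivative suffices: the fundamental theorem is used on compact intervals
    exhausting []0, +oo[], and no limit of [F] at 0 or at infinity is taken. The right end [n.+2]
    keeps the interval nondegenerate at [n = 0]. *)
Lemma ge0_integral_pos_le (f F : R -> R) (l : R) :
  (forall x : R, 0 < x -> {for x, continuous f}) ->
  (forall x : R, 0 < x -> 0 <= f x) ->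
  (forall x : R, 0 < x -> is_derive x 1 F (f x)) ->
  (forall x : R, 0 < x -> 0 <= F x <= l) ->
  (\int[mu]_(x in `]0%R, +oo[) (f x)%:E <= l%:E)%E.
Proof.
move=> cf f0 dF Fl.
pose J n : set R := `[n.+1%:R^-1, n.+2%:R]%classic.
have UJ : `]0, +oo[%classic = \bigcup_n J n.
  apply/seteqP; split=> [x|x [n _]]; rewrite /J /= !in_itv /= ?andbT; last first.
    by move=> /andP[nx _]; apply: lt_le_trans nx; rewrite invr_gt0.
  move=> x0; pose m := Num.trunc (x + x^-1); exists m => //=; rewrite in_itv /=.
  have xm : x + x^-1 < m.+1%:R by exact: truncnS_gt.
  have xi : 0 < x^-1 by rewrite invr_gt0.
  apply/andP; split; last first.
    by apply: ltW; apply: lt_trans (lt_trans xm _); rewrite ?ltrDl // ltr_nat.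
  by rewrite invf_ple ?posrE // ltW //; apply: lt_trans xm; rewrite ltrDr.
have mf : measurable_fun (`]0, +oo[%classic : set R) f.
  apply: open_continuous_measurable_fun => //.
  by move=> x; rewrite inE /= in_itv /= andbT; exact: cf.
have JS n : J n `<=` `]0, +oo[%classic by rewrite UJ; exact: bigcup_sup.
have mJ n : measurable_fun (J n) (EFin \o f).
  by apply/measurable_EFinP; apply: measurable_funS mf.
have f0J n x : J n x -> (0 <= (EFin \o f) x)%E.
  by move=> /JS; rewrite /= in_itv /= andbT lee_fin; exact: f0.
have ndJ : nondecreasing_seq J.
  apply/nondecreasing_seqP => n; rewrite subsetEset => x.
  rewrite /J /= !in_itv /= => /andP[x1 x2]; apply/andP; split.
    by apply: le_trans x1; rewrite lef_pV2 ?posrE // ler_nat.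
  by apply: le_trans x2 _; rewrite ler_nat.
have lim : (\int[mu]_(x in J n) (f x)%:E)%E @[n --> \oo] -->
    (\int[mu]_(x in `]0%R, +oo[) (f x)%:E)%E.
  by rewrite UJ; apply: ge0_nondecreasing_set_cvg_integral => // n; exact: measurable_itv.
rewrite -(cvg_lim _ lim) //; apply: lime_le.
  exact: cvgP lim.
apply: nearW => n /=; rewrite /J.
have n0 (x : R) : n.+1%:R^-1 <= x <= n.+2%:R -> 0 < x.
  by move=> /andP[nx _]; apply: lt_le_trans nx; rewrite invr_gt0.
have nn : n.+1%:R^-1 < n.+2%:R :> R.
  by apply: (@le_lt_trans _ _ 1); rewrite ?invf_le1 ?ler1n // ltr1n.
rewrite (FTC2_is_derive nn (fun x h => cf x (n0 x h)) (fun x h => dF x (n0 x h))).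
have /andP[_ Fb] := Fl n.+2%:R (ltr0Sn _ _).
have i0 : 0 < n.+1%:R^-1 :> R by rewrite invr_gt0.
have /andP[Fa _] := Fl _ i0.
rewrite lee_fin; lra.
Qed.

(** Unnormalized gamma density of shape [k] and rate [c]; for [k = 0] and [c = b] it is the Levy
    density up to the factor [a]. *)
Definition gamma_kernel (k c x : R) : R :=
  if 0 < x then x `^ (k - 1) * expR (- (c * x)) else 0.

Lemma gamma_kernel_ge0 k c x : 0 <= gamma_kernel k c x.
Proof.
by rewrite /gamma_kernel; case: ifP => // x0; rewrite mulr_ge0 ?powR_ge0 ?expR_ge0.
Qed.

Lemma gamma_kernelE k c : gamma_kernel k c =
  (fun x => x `^ (k - 1) * expR (- (c * x))) \_ `]0, +oo[.
Proof.
by apply/funext => x; rewrite patchE /gamma_kernel mem_setE in_itv /= andbT.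
Qed.

Lemma measurable_gamma_kernel k c : measurable_fun [set: R] (gamma_kernel k c).
Proof.
have mg : measurable_fun [set: R] (fun x => x `^ (k - 1) * expR (- (c * x))).
  by apply: measurable_funM; [exact: measurable_powR|exact: measurable_exp].
rewrite gamma_kernelE; apply/(measurable_restrictT _ (measurable_itv _)).
exact: measurable_funTS.
Qed.

Lemma exp_dominates_powR (c p : R) : 0 < c -> 0 < p ->
  exists2 K, 0 < K & forall x, 0 < x -> (1 + x) `^ p * expR (- (c * x)) <= K.
Proof.
move=> c0 p0; pose K := 1 + p / c.
have K0 : 0 < K by rewrite addr_gt0 ?divr_gt0.
exists (K `^ p); first exact: powR_gt0.
move=> x x0; rewrite expRN ler_pdivrMr ?expR_gt0 //.
have -> : expR (c * x) = expR (c / p * x) `^ p.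
  by rewrite /powR gt_eqF ?expR_gt0 // expRK; congr expR; field; rewrite gt_eqF.
rewrite -powRM ?expR_ge0 ?(ltW K0) // ge0_ler_powR ?nnegrE ?(ltW p0) //.
- by rewrite addr_ge0 // ltW.
- by rewrite mulr_ge0 ?expR_ge0 // ltW.
- have h := @expR_ge1Dx R (c / p * x).
  apply: (@le_trans _ _ (K * (1 + c / p * x))); last by rewrite ler_pM2l.
  have -> : K * (1 + c / p * x) = 1 + x + p / c + c / p * x.
    by rewrite /K; field; rewrite !gt_eqF.
  by rewrite -addrA lerDl addr_ge0 ?mulr_ge0 ?invr_ge0 // ltW.
Qed.

(** Comparison with [g], the derivative of the bounded function [(x / (1 + x)) ^ k]. It equals
    [k * x ^ (k - 1) * (1 + x) ^ (- k - 1)], so it has the right singularity at 0 for every [k > 0],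
    and the remaining factor [(1 + x) ^ (k + 1) * expR (- (c * x))] is bounded. *)
Lemma L1_gamma_kernel (k c : R) : 0 < k -> 0 < c -> L1 mu (gamma_kernel k c).
Proof.
move=> k0 c0.
pose r (x : R) : R := x / (1 + x).
pose g (x : R) : R := k * (r x) `^ (k - 1) * (1 + x) ^- 2.
have x1 (x : R) : 0 < x -> 1 + x != 0 by move=> x0; rewrite gt_eqF // addr_gt0.
have r0 (x : R) : 0 < x -> 0 < r x by move=> x0; rewrite divr_gt0 // addr_gt0.
have dr (x : R) : 0 < x -> is_derive x 1 r ((1 + x) ^- 2).
  move=> x0; rewrite /r.
  apply: is_derive_eq; first apply: is_deriveM; first by apply: is_deriveV; exact: x1.
  rewrite /GRing.scale /= ; field; exact: x1.
have dF (x : R) : 0 < x -> is_derive x 1 (fun x => (r x) `^ k) (g x).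
  move=> x0; have dp := is_derive1_powR k (r0 _ x0).
  have := is_derive1_comp dp (dr _ x0).
  by move=> h; apply: is_derive_eq h _; rewrite /g mulrC.
have g0 (x : R) : 0 < x -> 0 <= g x.
  move=> x0; rewrite /g mulr_ge0 ?invr_ge0 ?exprn_ge0 ?addr_ge0 ?(ltW x0) //.
  by rewrite mulr_ge0 ?powR_ge0 ?(ltW k0).
have cg (x : R) : 0 < x -> {for x, continuous g}.
  move=> x0; apply: differentiable_continuous; apply/derivable1_diffP.
  have dp := is_derive1_powR (k - 1) (r0 _ x0).
  have dc := is_derive1_comp dp (dr _ x0).
  have dx := dr _ x0.
  rewrite /g; apply: derivableM; first by apply: derivableM => //; exact: ex_derive.
  by apply: derivableV => //; rewrite expf_neq0 // x1.
have ig : (\int[mu]_(x in `]0%R, +oo[) (g x)%:E <= 1%:E)%E.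
  apply: ge0_integral_pos_le cg g0 dF _ => x x0.
  rewrite powR_ge0 /=; have -> : 1 = 1 `^ k :> R by rewrite powR1.
  rewrite ge0_ler_powR ?nnegrE ?(ltW k0) ?(ltW (r0 _ x0)) //.
  by rewrite ler_pdivrMr ?addr_gt0 // mul1r lerDr.
have mg : measurable_fun (`]0, +oo[%classic : set R) g.
  by apply: open_continuous_measurable_fun => // x; rewrite inE /= in_itv /= andbT; exact: cg.
have Lg : L1 mu (g \_ `]0, +oo[).
  apply: L1_restrict; first exact: measurable_itv.
  apply/integrableP; split; first exact/measurable_EFinP.
  apply: le_lt_trans (ltry 1); apply: le_trans ig; rewrite le_eqVlt; apply/orP; left; apply/eqP.
  apply: eq_integral => x; rewrite inE /= in_itv /= andbT => x0.
  by rewrite ger0_norm ?g0.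
have [K K0 expK] := exp_dominates_powR c0 (ltr_wpDr ler01 k0).
apply: (L1_le _ _ (L1Z (K / k) Lg)); first exact: measurable_gamma_kernel.
move=> x; rewrite ger0_norm ?gamma_kernel_ge0 // patchE mem_setE in_itv /= andbT.
rewrite /gamma_kernel; case: ifPn => [x0|_]; last by rewrite mulr0.
have -> : x `^ (k - 1) * expR (- (c * x)) = g x / k * ((1 + x) `^ (k + 1) * expR (- (c * x))).
  have {1}-> : x = r x * (1 + x) by rewrite /r divfK // x1.
  rewrite powRM ?(ltW (r0 _ x0)) ?addr_ge0 ?(ltW x0) //.
  have -> : k + 1 = k - 1 + 2%:R by rewrite -addrA; congr (_ + _); lra.
  rewrite [(1 + x) `^ (_ + 2%:R)]powRD; last by apply/implyP => _; exact: x1.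
  rewrite powR_mulrn ?addr_ge0 ?(ltW x0) // /g; field.
  by rewrite (x1 _ x0) gt_eqF.
have -> : K / k * g x = g x / k * K by ring.
by rewrite ler_wpM2l ?expK // divr_ge0 ?g0 ?(ltW k0).
Qed.

Lemma Gamma_funE (k : R) : Gamma_fun k = \int[mu]_x gamma_kernel k 1 x.
Proof.
rewrite /Gamma_fun gamma_kernelE -Rintegral_mkcond.
by apply: eq_Rintegral => x _; rewrite mul1r.
Qed.

Lemma Gamma_fun_gt0 (k : R) : 0 < k -> 0 < Gamma_fun k.
Proof.
move=> k0; rewrite Gamma_funE lt0r Rintegral_ge0 ?andbT; last first.
  by move=> x _; exact: gamma_kernel_ge0.
apply/negP => /eqP I0; have ik := L1_gamma_kernel k0 ltr01.
have mk := measurable_gamma_kernel k 1.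
have : (\int[mu]_x `|(gamma_kernel k 1 x)%:E| = 0)%E.
  under eq_integral do rewrite gee0_abs ?lee_fin ?gamma_kernel_ge0 //.
  by rewrite -EFin_Rintegral // I0.
move/(ae_eq_integral_abs _ measurableT) => h.
have [|N [mN N0 Nk]] := h; first exact/measurable_EFinP.
have : (mu `]0%R, 1%R[ <= mu N)%E.
  apply: le_measure; rewrite ?inE //; apply: subset_trans Nk.
  move=> x /=; rewrite in_itv /= => /andP[x0 _] /(_ I) [] /eqP.
  by rewrite /gamma_kernel x0 mulf_eq0 !gt_eqF ?powR_gt0 ?expR_gt0.
by rewrite N0 lebesgue_measure_itv /= lte_fin ltr01 oppr0 adde0 lee_fin ler10.
Qed.

Lemma Rintegral_gamma_kernel (k c : R) : 0 < k -> 0 < c ->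
  \int[mu]_x gamma_kernel k c x = c `^ (- k) * Gamma_fun k.
Proof.
move=> k0 c0; rewrite Gamma_funE.
have -> : \int[mu]_x gamma_kernel k 1 x = c * \int[mu]_x gamma_kernel k 1 (c * x).
  have mk := measurable_gamma_kernel k 1.
  have mk' : measurable_fun [set: R] (fun x => gamma_kernel k 1 (c * x)).
    by apply: (measurableT_comp mk); exact: measurable_funM.
  rewrite /Rintegral (@integral_affine _ c 0 c0 (EFin \o gamma_kernel k 1));
    last exact/measurable_EFinP.
  have -> : (\int[mu]_x (EFin \o gamma_kernel k 1) (c * x + 0)%R =
     \int[mu]_x (gamma_kernel k 1 (c * x)%R)%:E)%E.
    by apply: eq_integral => x _; rewrite addr0.
  have : (0 <= \int[mu]_x (gamma_kernel k 1 (c * x)%R)%:E)%E.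
    by apply: integral_ge0 => x _; rewrite lee_fin gamma_kernel_ge0.
  case: (\int[mu]_x _)%E => [s| |] //= _; first by rewrite gt0_muley ?lte_fin //= mulr0.
rewrite mulrA -Rintegral_scale //.
  apply: eq_Rintegral => x _; rewrite /gamma_kernel pmulr_rgt0 //; case: ifPn => x0;
    last by rewrite mulr0.
  have c1 : c `^ (- k) * c * c `^ (k - 1) = 1.
    rewrite -{2}[c]powRr1 ?(ltW c0) // -!powRD ?(gt_eqF c0) ?implybT //.
    by rewrite (_ : - k + 1 + (k - 1) = 0) ?powRr0 //; ring.
  rewrite powRM ?(ltW c0) ?(ltW x0) // mul1r.
  transitivity ((c `^ (- k) * c * c `^ (k - 1)) * (x `^ (k - 1) * expR (- (c * x)))).
    by rewrite c1 mul1r.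
  ring.
apply: (measurableT_comp (measurable_gamma_kernel k 1)); exact: measurable_funM.
Qed.

End gamma.

Section gamma_density.
Context {R : realType}.
Local Notation mu := (@lebesgue_measure R).
Variables (a b : R).
Hypotheses (a0 : 0 < a) (b0 : 0 < b).
Local Notation gam := (gamma_density a b).
Local Notation Phi := (gamma_exponent a b).

Lemma gamma_densityE t x :
  gam t x = b `^ (a * t) / Gamma_fun (a * t) * gamma_kernel (a * t) b x.
Proof.
by rewrite /gamma_density /gamma_kernel; case: ifP => _; rewrite ?mulr0 // mulrA.
Qed.

Lemma gamma_density_ge0 t x : 0 < t -> 0 <= gam t x.
Proof.
move=> t0; rewrite gamma_densityE mulr_ge0 ?gamma_kernel_ge0 //.
by rewrite divr_ge0 ?powR_ge0 // ltW // Gamma_fun_gt0 // mulr_gt0.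
Qed.

Lemma L1_gamma_density t : 0 < t -> L1 mu (gam t).
Proof.
move=> t0; rewrite (_ : gam t = fun x => b `^ (a * t) / Gamma_fun (a * t) * gamma_kernel (a *
  t) b x).
  by apply/L1Z/L1_gamma_kernel => //; rewrite mulr_gt0.
by apply/funext => x; rewrite gamma_densityE.
Qed.

Lemma pos_supp_gamma_density t : pos_supp (gam t).
Proof. by move=> x x0; rewrite /gamma_density ltNge x0. Qed.

Lemma Phi_ge0 l : 0 <= l -> 0 <= Phi l.
Proof.
by move=> l0; rewrite mulr_ge0 ?(ltW a0) // ln_ge0 // lerDl divr_ge0 // ltW.
Qed.

(** The exponential weight shifts the rate from [b] to [b + l], so the transform is a ratio of
    normalizing constants. *)
Lemma lap_gamma_density t l : 0 < t -> 0 <= l ->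
  lap l (gam t) = expR (- (t * Phi l)).
Proof.
move=> t0 l0; have at0 : 0 < a * t by rewrite mulr_gt0.
have bl0 : 0 < b + l by rewrite ltr_wpDr.
have -> : lap l (gam t) =
    \int[mu]_x (b `^ (a * t) / Gamma_fun (a * t) * gamma_kernel (a * t) (b + l) x).
  apply: eq_Rintegral => x _; rewrite gamma_densityE mulrCA; congr (_ * _).
  rewrite /gamma_kernel; case: ifP => _; last by rewrite mulr0.
  by rewrite mulrCA -expRD; congr (_ * expR _); ring.
rewrite Rintegral_scale //; last exact: measurable_gamma_kernel.
rewrite Rintegral_gamma_kernel //.
have G0 := Gamma_fun_gt0 at0.
have -> : b `^ (a * t) / Gamma_fun (a * t) * ((b + l) `^ (- (a * t)) * Gamma_fun (a * t)) =
  b `^ (a * t) * (b + l) `^ (- (a * t)) by field; rewrite gt_eqF.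
rewrite /powR !gt_eqF // -expRD /gamma_exponent; congr expR.
have -> : 1 + l / b = (b + l) / b by field; rewrite gt_eqF.
by rewrite ln_div ?posrE //; ring.
Qed.

Lemma Rintegral_gamma_density t : 0 < t -> \int[mu]_x gam t x = 1.
Proof.
move=> t0; have := lap_gamma_density t0 (lexx 0).
rewrite /gamma_exponent mul0r addr0 ln1 !mulr0 oppr0 expR0 => <-.
by apply: eq_Rintegral => x _; rewrite mul0r oppr0 expR0 mul1r.
Qed.

(** A domination uniform in the shape: [x ^ (k - 1)] is nondecreasing in [k] for [x >= 1] and
    nonincreasing for [x <= 1], so one of the extreme shapes always dominates. *)
Lemma gamma_kernel_sandwich (k0 k1 k c x : R) : k0 <= k <= k1 ->
  gamma_kernel k c x <= gamma_kernel k0 c x + gamma_kernel k1 c x.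
Proof.
move=> /andP[k0k kk1]; rewrite /gamma_kernel; case: ifP => x0; last by rewrite addr0.
rewrite -mulrDl ler_wpM2r ?expR_ge0 //.
have [x1|x1] := leP 1 x.
  by apply: ler_wpDl; rewrite ?powR_ge0 // ler_powR // lerB.
by apply: ler_wpDr; rewrite ?powR_ge0 // ger_powR ?x0 ?(ltW x1) // lerB.
Qed.

Lemma powR_cvg_exponent (x : R) (u : nat -> R) (k : R) : 0 < x ->
  u n @[n --> \oo] --> k -> x `^ (u n) @[n --> \oo] --> x `^ k.
Proof.
move=> x0 uk; rewrite /powR gt_eqF //.
apply: continuous_cvg; first exact: continuous_expR.
by apply: cvgM uk _; exact: cvg_cst.
Qed.

Lemma gamma_kernel_cvg (u : nat -> R) (k c x : R) : u n @[n --> \oo] --> k ->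
  gamma_kernel (u n) c x @[n --> \oo] --> gamma_kernel k c x.
Proof.
move=> uk; rewrite /gamma_kernel; case: ifP => x0; last exact: cvg_cst.
apply: cvgM; last exact: cvg_cst.
by apply: powR_cvg_exponent => //; apply: cvgB => //; exact: cvg_cst.
Qed.

Lemma Gamma_fun_cvg (u : nat -> R) (l h k : R) : 0 < l ->
  (forall n, l <= u n <= h) -> u n @[n --> \oo] --> k ->
  Gamma_fun (u n) @[n --> \oo] --> Gamma_fun k.
Proof.
move=> l0 ulh uk.
rewrite (_ : (fun n => Gamma_fun (u n)) = fun n => \int[mu]_x gamma_kernel (u n) 1 x); last first.
  by apply/funext => n; rewrite Gamma_funE.
have h0 : 0 < h by have /andP[h1 h2] := ulh 0%N; lra.
rewrite Gamma_funE; apply: (@Rdominated_cvg _ _ _ mu (fun n => gamma_kernel (u n) 1) _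
  (fun x => gamma_kernel l 1 x + gamma_kernel h 1 x)).
- by move=> n; exact: measurable_gamma_kernel.
- exact: measurable_gamma_kernel.
- by apply: aeW => x; exact: gamma_kernel_cvg.
- by apply: L1D; exact: L1_gamma_kernel.
- by move=> n x; rewrite ger0_norm ?gamma_kernel_ge0 //; exact: gamma_kernel_sandwich.
Qed.

(** The positive lower bound on the times makes dominated convergence possible: as the shape tends
    to 0 the densities concentrate at 0 and have no limit in [L1]. *)
Lemma gamma_density_cvg_L1 (u : nat -> R) (l h t : R) : 0 < l ->
  (forall n, l <= u n <= h) -> 0 < t -> u n @[n --> \oo] --> t ->
  \int[mu]_x `|gam (u n) x - gam t x| @[n --> \oo] --> 0.
Proof.
move=> l0 ulh t0 ut; have al0 : 0 < a * l by rewrite mulr_gt0.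
have h0 : 0 < h by have /andP[h1 h2] := ulh 0%N; lra.
have un0 n : 0 < u n by have /andP[h1 h2] := ulh n; lra.
have aulh n : a * l <= a * u n <= a * h by rewrite !ler_pM2l.
have aut : a * u n @[n --> \oo] --> a * t by apply: cvgM ut; exact: cvg_cst.
pose C s := b `^ (a * s) / Gamma_fun (a * s).
have Cc : C (u n) @[n --> \oo] --> C t.
  apply: cvgM; first exact: powR_cvg_exponent.
  apply: cvgV; first by rewrite gt_eqF // Gamma_fun_gt0 // mulr_gt0.
  exact: Gamma_fun_cvg al0 aulh aut.
have [M M0 CM] : exists2 M, 0 < M & forall n, `|C (u n)| <= M.
  have := pinfty_ex_gt0 (cvg_seq_bounded (cvgP _ Cc)).
  by move=> [M M0 /= CM]; exists M => // n; exact: CM.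
have -> : 0 = \int[mu]_x (cst 0 x) :> R by rewrite Rintegral_cst // mul0r.
have mg s : 0 < s -> measurable_fun [set: R] (gam s).
  by move=> s0; exact: L1_measurable (L1_gamma_density s0).
apply: (@Rdominated_cvg _ _ _ mu (fun n x => `|gam (u n) x - gam t x|) _
  (fun x => M * (gamma_kernel (a * l) b x + gamma_kernel (a * h) b x) + gam t x)).
- by move=> n; apply: measurableT_comp => //; apply: measurable_funB; exact: mg.
- exact: measurable_cst.
- apply: aeW => x; rewrite -[X in _ --> X](normr0 R) -[X in `|X|](subrr (gam t x)).
  apply: cvg_norm; apply: cvgB; last exact: cvg_cst.
  rewrite (_ : (fun n => gam (u n) x) = (fun n => C (u n) * gamma_kernel (a * u n) b x));
    last first.
    by apply/funext => n; rewrite gamma_densityE.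
  by rewrite gamma_densityE; apply: cvgM => //; exact: gamma_kernel_cvg.
- apply: L1D; last exact: L1_gamma_density.
  by apply: L1Z; apply: L1D; apply: L1_gamma_kernel => //; rewrite mulr_gt0.
- move=> n x; rewrite normr_id (le_trans (ler_normB _ _)) //.
  rewrite [X in _ + X]ger0_norm ?gamma_density_ge0 // lerD2r.
  rewrite gamma_densityE normrM [X in _ * X]ger0_norm ?gamma_kernel_ge0 //.
  by apply: ler_pM => //; [exact: gamma_kernel_ge0|exact: CM|exact: gamma_kernel_sandwich].
Qed.

End gamma_density.

(** * The tail of the Levy measure *)

Section exponential_integrals.
Context {R : realType}.
Local Notation mu := (@lebesgue_measure R).

Lemma Rintegral_indic_mul (D : set R) (f : R -> R) :
  \int[mu]_x (\1_D x * f x) = \int[mu]_(x in D) f x.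
Proof.
rewrite [RHS]Rintegral_mkcond; apply: eq_Rintegral => y _.
by rewrite patchE indicE; case: ifPn => _; rewrite ?mul1r ?mul0r.
Qed.

Lemma is_derive_exp (l y : R) :
  is_derive y 1 (fun y => expR (- (l * y))) (- l * expR (- (l * y))).
Proof.
have d1 : is_derive y 1 (fun y => - (l * y)) (- l).
  by apply: is_derive_eq; rewrite /GRing.scale /= mulr1.
have h := @is_derive1_comp _ expR (fun y => - (l * y)) _ _ _ (is_derive_expR _) d1.
by apply: is_derive_eq h _; rewrite mulrC.
Qed.

Lemma Rintegral_exp_itv (l x : R) : l != 0 -> 0 < x ->
  \int[mu]_y (\1_`]0, x[ y * expR (- (l * y))) = (1 - expR (- (l * x))) / l.
Proof.
move=> l0 x0; rewrite Rintegral_indic_mul.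
have ex (y : R) : is_derive y 1 (fun y => - expR (- (l * y)) / l) (expR (- (l * y))).
  have d := is_derive_exp l y.
  have -> : (fun y => - expR (- (l * y)) / l) = (- l^-1) \*: (fun y => expR (- (l * y))).
    by apply/funext => z /=; rewrite /GRing.scale /= mulNr mulrC mulNr.
  by apply: is_derive_eq; rewrite /GRing.scale /=; field.
have c (y : R) : {for y, continuous (fun y => expR (- (l * y)))}.
  have d := is_derive_exp l y.
  by apply: differentiable_continuous; apply/derivable1_diffP; exact: ex_derive.
have mE : measurable_fun [set: R] (fun y => expR (- (l * y))) by exact: measurable_exp.
have mE' : measurable_fun (`]0, x[%classic : set R) (fun y => (expR (- (l * y)))%:E).
  by apply/measurable_EFinP; exact: measurable_funTS.
rewrite /Rintegral -(integral_itv_bndoo true false mE').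
have /= -> := FTC2_is_derive x0 (fun y _ => c y) (fun y _ => ex y).
by rewrite mulr0 oppr0 expR0 /=; field.
Qed.

Lemma Rintegral_exp_pos (c : R) : 0 < c ->
  \int[mu]_x (\1_`]0, +oo[ x * expR (- (c * x))) = c^-1.
Proof.
move=> c0; have := integral_exponential_pdf c0 => h.
have mE : measurable_fun (`]0, +oo[%classic : set R) (fun x => (expR (- (c * x)))%:E).
  by apply/measurable_EFinP; apply: measurable_funTS; exact: measurable_exp.
have -> : \int[mu]_x (\1_`]0, +oo[ x * expR (- (c * x))) =
    \int[mu]_(x in `[0, +oo[) expR (- (c * x)).
  by rewrite Rintegral_indic_mul /Rintegral integral_itv_obnd_cbnd.
have <- : c^-1 * \int[mu]_x exponential_pdf c x = c^-1 by rewrite /Rintegral h mulr1.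
rewrite Rintegral_mkcond.
rewrite -Rintegral_scale //; last exact: measurable_exponential_pdf.
apply: eq_Rintegral => x _; rewrite /exponential_pdf !patchE; case: ifPn => _;
  last by rewrite mulr0.
by rewrite mulrA mulVf ?mul1r ?mulNr // gt_eqF.
Qed.

Lemma L1_exp_pos (c : R) : 0 < c -> L1 mu (fun x => \1_`]0, +oo[ x * expR (- (c * x))).
Proof.
move=> c0; have := L1_gamma_kernel ltr01 c0; congr integrable.
apply/funext => x /=; rewrite /gamma_kernel subrr powRr0 mul1r indicE mem_setE in_itv /= andbT.
by case: ifP; rewrite ?mul1r ?mul0r.
Qed.

Lemma L1_prod_fun (f g : R -> R) : L1 mu f -> L1 mu g ->
  L1 (mu \x mu)%E (fun z : R * R => f z.1 * g z.2).
Proof.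
move=> fi gi; have mf := L1_measurable fi; have mg := L1_measurable gi.
have mk : measurable_fun setT (fun z : R * R => f z.1 * g z.2).
  by apply: measurable_funM; [exact: (measurableT_comp mf)|exact: (measurableT_comp mg)].
apply/integrable12ltyP; first exact/measurable_EFinP.
rewrite /=.
under eq_integral => x _.
  under eq_integral => y _ do rewrite normrM EFinM.
  rewrite ge0_integralZl //; last first.
    by apply/measurable_EFinP; apply: measurableT_comp.
  over.
move/integrableP: (fi) => [_ /= ffin]; move/integrableP: (gi) => [_ /= gfin].
rewrite /= ge0_integralZr //; last 2 first.
- by apply/measurable_EFinP; apply: measurableT_comp.
- by apply: integral_ge0.
apply: lte_mul_pinfty => //; first exact: integral_ge0.
by rewrite ge0_fin_numE //; exact: integral_ge0.
Qed.

Lemma Rintegral_inv_itv (b l : R) : 0 < b -> 0 < l ->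
  \int[mu]_u (\1_`]0, l[ u * (b + u)^-1) = ln (1 + l / b).
Proof.
move=> b0 l0; rewrite Rintegral_indic_mul.
have ex (u : R) : 0 <= u <= l -> is_derive u 1 (fun u => ln (b + u)) ((b + u)^-1).
  move=> /andP[u0 _]; have bu : 0 < b + u by lra.
  have d1 := is_derive1_ln bu.
  by apply: is_derive_eq; rewrite add0r mulr1.
have c (u : R) : 0 <= u <= l -> {for u, continuous (fun u => (b + u)^-1)}.
  move=> /andP[u0 _]; have bu : 0 < b + u by lra.
  apply: cvgV; first by rewrite gt_eqF.
  by apply: cvgD; [exact: cvg_cst|exact: cvg_id].
have mE : measurable_fun (`]0, l[%classic : set R) (fun u => (b + u)^-1).
  apply: open_continuous_measurable_fun => // u; rewrite inE /= in_itv /= => /andP[u0 ul].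
  by apply: c; rewrite !ltW.
have mE' : measurable_fun (`]0, l[%classic : set R) (fun u => ((b + u)^-1)%:E).
  exact/measurable_EFinP.
rewrite /Rintegral -(integral_itv_bndoo true false mE').
have /= -> := FTC2_is_derive l0 c ex; rewrite addr0 -ln_div ?posrE ?addr_gt0 //.
by congr ln; field; rewrite gt_eqF.
Qed.

End exponential_integrals.

Section levy_tail.
Context {R : realType}.
Local Notation mu := (@lebesgue_measure R).
Variables (a b : R).
Hypotheses (a0 : 0 < a) (b0 : 0 < b).

Let q z := a * gamma_kernel 0 b z.
(** Integrating [F] in its second variable gives the tail, and in its first variable
    [z * q z = a * expR (- (b * z))]. By Tonelli the tail is integrable in spite of its logarithmic
    singularity at 0. *)
Let F (s : R * R) : R := \1_`]0, s.2[ s.1 * q s.2.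

(** Cut off on the negative half-line, which turns the integral over [[0, z]] of the operator into a
    convolution on the line. *)
Definition pos_levy_tail (y : R) : R := if 0 < y then levy_tail a b y else 0.

Let measurable_F : measurable_fun setT F.
Proof.
apply: measurable_funM; last first.
  by apply: measurable_funM => //; apply: (measurableT_comp (measurable_gamma_kernel 0 b)).
have -> : (fun s : R * R => \1_`]0, s.2[ s.1 : R) =
    \1_[set s : R * R | (0 < s.1) && (s.1 < s.2)].
  by apply/funext => s; rewrite !indicE !mem_setE in_itv.
apply: measurable_indic.
rewrite (_ : [set s | _] = (fst @^-1` `]0, +oo[) `&`
    ((fun s : R * R => s.2 - s.1) @^-1` `]0, +oo[)); last first.
  by apply/seteqP; split => s /=; rewrite !in_itv /= !andbT subr_gt0 => /andP.
apply: measurableI; rewrite -[X in measurable X]setTI.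
  exact: measurable_fst.
by apply: (@measurable_funB _ _ _ _ snd fst); [exact: measurable_snd|exact: measurable_fst|..].
Qed.

Let q_ge0 z : 0 <= q z.
Proof. by rewrite mulr_ge0 ?(ltW a0) // gamma_kernel_ge0. Qed.

Let F_ge0 s : 0 <= F s.
Proof. by rewrite mulr_ge0 ?q_ge0. Qed.

Let L1_F : L1 (mu \x mu)%E F.
Proof.
apply/integrable21ltyP; first exact/measurable_EFinP.
rewrite /=.
under eq_integral => z _.
  have -> : (\int[mu]_y `|(F (y, z))|%:E = (a * (\1_`]0, +oo[ z * expR (- (b * z))))%:E)%E.
    have [z0|z0] := leP z 0.
      rewrite indicE memNset ?mul0r ?mulr0; last by rewrite /= in_itv /= andbT ltNge z0.
      apply: integral0_eq => y _; rewrite /F /q /gamma_kernel ltNge z0 /= mulr0 mulr0 normr0 //.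
    under eq_integral => y _.
      rewrite ger0_norm ?F_ge0 // /F /= mulrC EFinM. over.
    rewrite ge0_integralZl //; last 2 first.
    - by apply/measurable_EFinP; exact: measurable_indic.
    - by rewrite lee_fin q_ge0.
    rewrite integral_indic // setIT.
    transitivity ((q z)%:E * z%:E)%E.
      congr (_ * _)%E; transitivity (mu `]0, z[); first by [].
      by rewrite lebesgue_measure_itv /= lte_fin z0 oppr0 adde0.
    rewrite -EFinM.
    rewrite /q /gamma_kernel z0 indicE mem_set ?mul1r; last by rewrite /= in_itv /= z0.
    by congr EFin; rewrite -mulrA; congr (_ * _);
      rewrite mulrAC sub0r powR_inv1 ?(ltW z0) // mulVf ?mul1r // gt_eqF.
  over.
have /integrableP[_] := L1Z a (L1_exp_pos b0); apply: le_lt_trans.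
rewrite le_eqVlt; apply/orP; left; apply/eqP; apply: eq_integral => z _ /=.
by rewrite ger0_norm // !mulr_ge0 ?expR_ge0 ?(ltW a0).
Qed.

Lemma pos_levy_tailE y : pos_levy_tail y = \int[mu]_z F (y, z).
Proof.
rewrite /pos_levy_tail; case: ifPn => [y0|]; last first.
  rewrite -leNgt => y0; rewrite -[LHS](mul0r (fine (mu setT))) -Rintegral_cst //.
  apply: eq_Rintegral => z _; rewrite /F /= indicE memNset ?mul0r //.
  by rewrite /= in_itv /= ltNge y0.
rewrite /levy_tail Rintegral_mkcond.
transitivity (\int[mu]_z (a * (\1_`]y, +oo[ z * gamma_kernel 0 b z))); last first.
  apply: eq_Rintegral => z _; rewrite /F /= mulrCA /q; congr (_ * _).
  by rewrite !indicE !mem_setE !in_itv /= y0 andbT.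
rewrite Rintegral_scale //; last first.
  by apply: measurable_funM; [exact: measurable_indic|exact: measurable_gamma_kernel].
congr (_ * _); apply: eq_Rintegral => z _.
rewrite patchE indicE mem_setE in_itv /= andbT /gamma_kernel; case: ifP => yz;
  last by rewrite mul0r.
have z0 : 0 < z by apply: lt_trans yz.
by rewrite z0 mul1r sub0r powR_inv1 ?(ltW z0) // mulrC.
Qed.

Lemma L1_pos_levy_tail : L1 mu pos_levy_tail.
Proof.
have -> : pos_levy_tail = fun y => \int[mu]_z F (y, z).
  by apply/funext => y; rewrite pos_levy_tailE.
exact: Rfubini_F_L1 L1_F.
Qed.

Lemma pos_supp_pos_levy_tail : pos_supp pos_levy_tail.
Proof. by move=> y y0; rewrite /pos_levy_tail ltNge y0. Qed.

(** Integrating in [y] first leaves [q z * (1 - expR (- (l * z))) / l]. As in Frullani's integrals,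
    [(1 - expR (- (l * z))) / z] is the integral of [expR (- (z * u))] over [0 < u < l]. A second
    exchange gives [1 / (b + u)], whose integral is the logarithm in [Phi]. *)
Lemma lap_pos_levy_tail l : 0 < l -> lap l pos_levy_tail = gamma_exponent a b l / l.
Proof.
move=> l0.
have mFy y : measurable_fun [set: R] (fun z => F (y, z)).
  apply: (measurableT_comp measurable_F); exact: measurable_pair1.
have me := measurable_exp l.
have LG : L1 (mu \x mu)%E (fun s : R * R => expR (- (l * s.1)) * F s).
  apply: L1_le L1_F.
    by apply: measurable_funM => //; apply: (measurableT_comp me); exact: measurable_fst.
  move=> [y z] /=; rewrite ger0_norm; last by rewrite mulr_ge0 ?expR_ge0 ?F_ge0.
  have [y0|y0] := leP y 0.
    rewrite /F /= indicE memNset ?mul0r ?mulr0 //.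
    by rewrite /= in_itv /= ltNge y0.
  rewrite ler_piMl ?F_ge0 // -expR0 ler_expR oppr_le0.
  by rewrite mulr_ge0 // ltW.
have -> : lap l pos_levy_tail = \int[mu]_y \int[mu]_z (expR (- (l * y)) * F (y, z)).
  apply: eq_Rintegral => y _; rewrite pos_levy_tailE Rintegral_scale //; exact: mFy.
rewrite (Rfubini LG) /=.
pose H (s : R * R) := (a * (\1_`]0, +oo[ s.1 * expR (- (b * s.1)))) * \1_`]0, l[ s.2 * expR (-
  (s.1 * s.2)).
have LH : L1 (mu \x mu)%E H.
  have L1l : L1 mu (\1_`]0, l[ : R -> R).
    exact: integrable_indic_itv.
  apply: L1_le (L1_prod_fun (L1Z a (L1_exp_pos b0)) L1l).
    apply: measurable_funM.
      exact: L1_measurable (L1_prod_fun (L1Z a (L1_exp_pos b0)) L1l).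
    have -> : (fun s : R * R => expR (- (s.1 * s.2))) = (fun x : R => expR (- (1 * x))) \o
      (fun s => s.1 * s.2).
      by apply/funext => s /=; rewrite mul1r.
    apply: (measurableT_comp (measurable_exp 1)).
    by apply: measurable_funM; [exact: measurable_fst|exact: measurable_snd].
  move=> [z u] /=; rewrite /H /= ger0_norm; last first.
    by rewrite mulr_ge0 ?expR_ge0 // mulr_ge0 // mulr_ge0 ?(ltW a0) // ?mulr_ge0 ?expR_ge0.
  rewrite !indicE !mem_setE !in_itv /= andbT.
  have [z0|z0] := ltP 0 z; last by rewrite !(mul0r, mulr0).
  have [/andP[u0 _]|_] := boolP (0 < u < l); last by rewrite !(mul0r, mulr0).
  rewrite !(mul1r, mulr1) ler_piMr ?mulr_ge0 ?expR_ge0 ?(ltW a0) //.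
  by rewrite -expR0 ler_expR oppr_le0 mulr_ge0 // ltW.
transitivity (l^-1 * \int[mu]_z \int[mu]_u H (z, u)).
  rewrite -Rintegral_scale //; last exact: Rfubini_F_measurable LH.
  apply: eq_Rintegral => z _.
  transitivity (q z * \int[mu]_y (\1_`]0, z[ y * expR (- (l * y)))).
    rewrite -Rintegral_scale //; last by apply: measurable_funM => //; exact: measurable_indic.
    by apply: eq_Rintegral => y _; rewrite /F /=; ring.
  have [z0|z0] := leP z 0.
    rewrite {1}/q /gamma_kernel ltNge z0 /= mulr0 mul0r.
    under eq_Rintegral => u _.
      have -> : H (z, u) = 0.
        rewrite /H /= indicE memNset ?mul0r ?mulr0 ?mul0r ?mul0r //.
        by rewrite /= in_itv /= andbT ltNge z0.
      over.
    by rewrite Rintegral_cst // mul0r mulr0.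
  rewrite Rintegral_exp_itv ?gt_eqF //.
  transitivity (l^-1 * (a * expR (- (b * z)) * \int[mu]_u (\1_`]0, l[ u * expR (- (z * u))))).
    rewrite Rintegral_exp_itv ?gt_eqF // /q /gamma_kernel z0 sub0r powR_inv1 ?(ltW z0) //.
    by rewrite [z * l]mulrC; field; rewrite !gt_eqF.
  congr (_ * _); rewrite -Rintegral_scale //; last first.
    by apply: measurable_funM; [exact: measurable_indic|exact: measurable_exp].
  apply: eq_Rintegral => u _; rewrite /H /= [\1_`]0, +oo[ z]indicE mem_set ?mul1r ?mulrA //.
  by rewrite /= in_itv /= z0.
rewrite (Rfubini LH) mulrC /gamma_exponent; congr (_ / _).
rewrite -(Rintegral_inv_itv b0 l0).
transitivity (a * (a^-1 * \int[mu]_u \int[mu]_z H (z, u))).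
  by rewrite mulrA divff ?mul1r // gt_eqF.
congr (_ * _); rewrite -Rintegral_scale //; last exact: Rfubini_F_measurable (L1_swap LH).
apply: eq_Rintegral => u _.
have [u0l|u0l] := boolP (0 < u < l); last first.
  have u1 : \1_`]0, l[ u = 0 :> R by rewrite indicE mem_setE in_itv /= (negbTE u0l).
  under eq_Rintegral => z _ do rewrite /H /= u1 mulr0 mul0r.
  by rewrite Rintegral_cst // mul0r mulr0 u1 mul0r.
have u1 : \1_`]0, l[ u = 1 :> R by rewrite indicE mem_setE in_itv /= u0l.
have bu0 : 0 < b + u by case/andP: u0l => u0 _; rewrite addr_gt0.
rewrite u1 mul1r -(Rintegral_exp_pos bu0) -Rintegral_scale //; last first.
  apply: (measurableT_comp (L1_measurable LH)); exact: measurable_pair2.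
apply: eq_Rintegral => z _; rewrite /H /= u1 mulr1 -!mulrA mulKf ?gt_eqF //.
by rewrite -expRD; congr (_ * expR _); ring.
Qed.
End levy_tail.

(** * Functions of class W^{1,1}_0 as primitives *)

Section quadratic_test_functions.
Context {R : realType}.
Local Notation mu := (@lebesgue_measure R).

(** Differentiates the square of a positive part at its junction point without one-sided
    derivatives. *)
Lemma is_derive_quadratic_remainder (f : R -> R) (x d C : R) :
  (forall h, `|f (x + h) - f x - d * h| <= C * h ^+ 2) -> is_derive x 1 f d.
Proof.
move=> fC.
have C0 : 0 <= C by have := le_trans (normr_ge0 _) (fC 1); rewrite expr1n mulr1.
have lim : h^-1 *: ((f \o shift x) (h *: 1) - f x) @[h --> 0^'] --> d.
  apply/cvgrPdist_le => e e0.
  near=> h.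
  have h0 : h != 0 by near: h; exact: nbhs_dnbhs_neq.
  have -> : d - h^-1 *: ((f \o shift x) (h *: 1) - f x) =
      - ((f (x + h) - f x - d * h) / h).
    by rewrite /GRing.scale /= mulr1 [h + x]addrC; field.
  rewrite normrN normrM normfV ler_pdivrMr ?normr_gt0 //.
  apply: le_trans (fC h) _; rewrite -real_normK ?num_real // expr2 mulrA ler_wpM2r //.
  rewrite (@le_trans _ _ ((C + 1) * `|h|)) ?ler_wpM2r ?lerDl //.
  rewrite mulrC -ler_pdivlMr ?ltr_wpDl //.
  near: h; apply: dnbhs0_le; rewrite divr_gt0 // ltr_wpDl //.
split.
  by apply/cvg_ex; exists d.
exact: cvg_lim lim.
Unshelve. all: by end_near. Qed.

Let m (u : R) : R := Num.max u 0.

(* Primitive of the triangular bump of width [2 * e] and mass 1 based at [y]. *)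
Definition tent_primitive (e y z : R) : R :=
  (m (z - y) ^+ 2 - 2 * m (z - y - e) ^+ 2 + m (z - y - 2 * e) ^+ 2) / (2 * e ^+ 2).

Definition tent (e y z : R) : R :=
  (m (z - y) - 2 * m (z - y - e) + m (z - y - 2 * e)) / e ^+ 2.

Lemma is_derive_tent (e y z : R) : 0 < e ->
  is_derive z 1 (tent_primitive e y) (tent e y z).
Proof.
move=> e0.
have d (c : R) : is_derive z 1 (fun z => m (z - c) ^+ 2) (2 * m (z - c)).
  apply: (@is_derive_quadratic_remainder _ _ _ 1) => h; rewrite mul1r /m.
  case: (leP (z + h - c) 0) => uh; case: (leP (z - c) 0) => u0; rewrite ler_norml; apply/andP;
    split; nra.
have d0 := d y; have d1 := d (y + e); have d2 := d (y + 2 * e).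
have -> : tent_primitive e y = (2 * e ^+ 2)^-1 \*: ((fun z => m (z - y) ^+ 2) - 2 \*: (fun z
  => m (z - (y + e)) ^+ 2)
   + (fun z => m (z - (y + 2 * e)) ^+ 2)).
  apply/funext => u; rewrite /tent_primitive !fctE /= !opprD !addrA.
  rewrite -[RHS]/((2 * e ^+ 2)^-1 *
    (m (u - y) ^+ 2 - 2 * m (u - y - e) ^+ 2 + m (u - y - 2 * e) ^+ 2)); field.
  by rewrite gt_eqF.
apply: is_derive_eq.
rewrite /tent /= !opprD !addrA -[LHS]/((2 * e ^+ 2)^-1 *
  (2 * m (z - y) - 2 * (2 * m (z - y - e)) + 2 * m (z - y - 2 * e))); field.
by rewrite gt_eqF.
Qed.

Lemma tent_primitive_le (e y z : R) : 0 < e -> z <= y -> tent_primitive e y z = 0.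
Proof.
move=> e0 zy; rewrite /tent_primitive /m.
by rewrite !max_r ?expr0n /= ?mulr0 ?subr0 ?addr0 ?mul0r //; lra.
Qed.

Lemma tent_primitive_ge (e y z : R) : 0 < e -> y + 2 * e <= z -> tent_primitive e y z = 1.
Proof.
move=> e0 zy; rewrite /tent_primitive /m !max_l; try lra.
by field; rewrite gt_eqF.
Qed.

Lemma tent_primitive_01 (e y z : R) : 0 < e -> 0 <= tent_primitive e y z <= 1.
Proof.
move=> e0; have e2 : 0 < 2 * e ^+ 2 by rewrite mulr_gt0 // exprn_gt0.
rewrite /tent_primitive ler_pdivlMr // ler_pdivrMr // mul0r mul1r /m.
case: (leP (z - y) 0) => h1; case: (leP (z - y - e) 0) => h2;
  case: (leP (z - y - 2 * e) 0) => h3; try lra; apply/andP; split; nra.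
Qed.

Lemma tent_ge0 (e y z : R) : 0 < e -> 0 <= tent e y z.
Proof.
move=> e0; rewrite /tent divr_ge0 ?exprn_ge0 ?(ltW e0) // /m.
by case: (leP (z - y) 0) => h1; case: (leP (z - y - e) 0) => h2;
  case: (leP (z - y - 2 * e) 0) => h3; lra.
Qed.

Lemma tent_le (e y z : R) : 0 < e -> tent e y z <= e^-1.
Proof.
move=> e0; rewrite /tent ler_pdivrMr ?exprn_gt0 // expr2 mulKf ?gt_eqF // /m.
by case: (leP (z - y) 0) => h1; case: (leP (z - y - e) 0) => h2;
  case: (leP (z - y - 2 * e) 0) => h3; lra.
Qed.

Lemma tent_out (e y z : R) : 0 < e -> ~~ (y <= z <= y + 2 * e) -> tent e y z = 0.
Proof.
move=> e0; rewrite negb_and -!ltNge => zo;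
  suff h : m (z - y) - 2 * m (z - y - e) + m (z - y - 2 * e) = 0.
  by rewrite /tent h mul0r.
rewrite /m; case/orP: zo => zo; first by rewrite !max_r; lra.
by rewrite !max_l; lra.
Qed.

Lemma continuous_tent (e y : R) : continuous (tent e y).
Proof.
have cm (c : R) : continuous (fun z => m (z - c)).
  move=> z; apply: (@continuous_max _ _ (fun z => z - c) (cst 0)).
    by apply: cvgB; [exact: cvg_id|exact: cvg_cst].
  exact: cst_continuous.
have -> : tent e y = fun z => (m (z - y) - 2 * m (z - (y + e)) + m (z - (y + 2 * e))) / e ^+ 2.
  by apply/funext => z; rewrite /tent !opprD !addrA.
move=> z; apply: cvgM; last exact: cvg_cst.
apply: cvgD; last exact: cm.
by apply: cvgB; [exact: cm|apply: cvgM; [exact: cvg_cst|exact: cm]].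
Qed.

Lemma tent_primitive_cvg (y z : R) (e : nat -> R) : (forall n, 0 < e n) ->
  e n @[n --> \oo] --> 0 -> tent_primitive (e n) y z @[n --> \oo] --> ((y < z)%R%:R : R).
Proof.
move=> e0 ec; have [yz|zy] := ltP y z.
  apply: cvg_near_cst; near=> n; rewrite tent_primitive_ge // -lerBrDl.
  rewrite mulrC -ler_pdivlMr //; apply: ltW; near: n.
  have yz2 : 0 < (z - y) / 2 by rewrite divr_gt0 // subr_gt0.
  by move/cvgrPdist_lt : ec => /(_ _ yz2); apply: filterS => k; rewrite sub0r normrN gtr0_norm.
by rewrite (_ : (fun n => _) = cst 0) ?tent_primitive_le //;
  [exact: cvg_cst|apply/funext => n; rewrite tent_primitive_le].
Unshelve. all: by end_near. Qed.

Lemma L1_tent_mul (e y : R) (f : R -> R) : 0 < e -> L1 mu f ->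
  L1 mu (fun z => f z * tent e y z).
Proof.
move=> e0 fi; apply: L1_le (L1Z e^-1 (L1_norm fi)).
  apply: measurable_funM; first exact: L1_measurable fi.
  by apply: continuous_measurable_fun; exact: continuous_tent.
move=> z; rewrite normrM mulrC ler_wpM2r // ger0_norm ?tent_ge0 //.
exact: tent_le.
Qed.

Lemma Rintegral_tent (e y : R) : 0 < e -> L1 mu (tent e y) /\ \int[mu]_z tent e y z = 1.
Proof.
move=> e0; have yy : y < y + 2 * e by lra.
have mt : measurable_fun [set: R] (tent e y).
  by apply: continuous_measurable_fun; exact: continuous_tent.
have tE : tent e y = tent e y \_ `[y, y + 2 * e].
  apply/funext => z; rewrite patchE mem_setE in_itv /=; case: ifPn => // zo.
  exact: tent_out.
have := FTC2_is_derive yy (fun z _ => continuous_tent (e := e) (y := y) (x := z))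
   (fun z _ => is_derive_tent y z e0).
rewrite (tent_primitive_le e0 (lexx y)) (tent_primitive_ge e0 (lexx _)) subr0 => h.
have it : mu.-integrable `[y, y + 2 * e] (EFin \o tent e y).
  apply/integrableP; split; first by apply/measurable_EFinP; exact: measurable_funTS.
  under eq_integral => z _ do rewrite /= ger0_norm ?tent_ge0 //.
  by rewrite h ltry.
split; first by rewrite tE; apply: L1_restrict.
by rewrite tE -Rintegral_mkcond /Rintegral h.
Qed.

Lemma Rintegral_tent_mul_cvg (f : R -> R) (y : R) (e : nat -> R) :
  L1 mu f -> {for y, continuous f} -> (forall n, 0 < e n) -> e n @[n --> \oo] --> 0 ->
  \int[mu]_z (f z * tent (e n) y z) @[n --> \oo] --> f y.
Proof.
move=> fi cf e0 ec; apply/cvgrPdist_le => eta eta0.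
have /nbhs_ballP[r /= r0 fr] : \forall z \near y, `|f y - f z| <= eta.
  by move/cvgrPdist_le: cf; exact.
near=> n.
have [ti t1] := Rintegral_tent y (e0 n).
have er : 2 * e n < r.
  rewrite mulrC -ltr_pdivlMr //; near: n.
  have r2 : 0 < r / 2 by rewrite divr_gt0.
  by move/cvgrPdist_lt : ec => /(_ _ r2); apply: filterS => k; rewrite sub0r normrN gtr0_norm.
have fti := L1_tent_mul y (e0 n) fi.
have bnd z : `|f y - f z| * tent (e n) y z <= eta * tent (e n) y z.
  have [zi|zo] := boolP (y <= z <= y + 2 * e n); last by rewrite tent_out ?mulr0.
  rewrite ler_wpM2r ?tent_ge0 //; apply: fr.
  have /andP[z1 z2] := zi; rewrite /ball /= ler0_norm; lra.
have -> : f y - \int[mu]_z (f z * tent (e n) y z) =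
    \int[mu]_z (f y * tent (e n) y z - f z * tent (e n) y z).
  rewrite RintegralB //; last exact: L1Z.
  by rewrite Rintegral_scale ?t1 ?mulr1 //; exact: L1_measurable ti.
have iB : L1 mu (fun z => f y * tent (e n) y z - f z * tent (e n) y z).
  by apply: L1B => //; exact: L1Z.
apply: le_trans (le_normr_Rintegral _ iB) _ => //.
rewrite -[leRHS]mulr1 -t1 -Rintegral_scale //; last exact: L1_measurable ti.
apply: le_Rintegral => //; [exact: L1_norm|exact: L1Z|].
move=> z _; rewrite -mulrBl normrM [X in _ * X]ger0_norm ?tent_ge0 //.
Unshelve. all: by end_near. Qed.

End quadratic_test_functions.

Section sobolev.
Context {R : realType}.
Local Notation mu := (@lebesgue_measure R).

Lemma pos_supp_restrict (f : R -> R) : pos_supp (f \_ `]0, +oo[).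
Proof.
by move=> x x0; rewrite patchE mem_setE in_itv /= andbT ltNge x0.
Qed.

Lemma restrict_pos (f : R -> R) (x : R) : 0 < x -> (f \_ `]0, +oo[) x = f x.
Proof. by move=> x0; rewrite patchE mem_setE in_itv /= andbT x0. Qed.

Lemma invS_cvg0 (c : R) : c / n.+1%:R @[n --> \oo] --> 0.
Proof.
rewrite -[X in _ --> X](mulr0 c); apply: cvgM; first exact: cvg_cst.
exact: cvg_harmonic.
Qed.

Lemma L1_indic_mul (f : R -> R) (D : set R) : measurable D -> L1 mu f ->
  L1 mu (fun z => f z * \1_D z).
Proof.
move=> mD fi; apply: L1_le (L1_norm fi).
  by apply: measurable_funM; [exact: L1_measurable fi|exact: measurable_indic].
by move=> z; rewrite normrM ler_piMr // indicE; case: (_ \in _); rewrite ?normr1 ?normr0.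
Qed.

Lemma prim_cvg0 (g : R -> R) (y : nat -> R) : L1 mu g -> pos_supp g ->
  y n @[n --> \oo] --> 0 -> prim g (y n) @[n --> \oo] --> 0.
Proof.
move=> gi sg yc.
rewrite (_ : (fun n => prim g (y n)) = fun n => \int[mu]_z (g z * \1_`]-oo, y n] z)); last first.
  by apply/funext => n; rewrite primE.
have -> : 0 = \int[mu]_x (cst 0 x) :> R by rewrite Rintegral_cst // mul0r.
apply: (@Rdominated_cvg _ _ _ mu (fun n z => g z * \1_`]-oo, y n] z) _ (fun z => `|g z|)).
- by move=> n; apply: measurable_funM; [exact: L1_measurable gi|exact: measurable_indic].
- exact: measurable_cst.
- apply: aeW => z; have [z0|z0] := leP z 0.
    rewrite (_ : (fun n => _) = cst 0); first exact: cvg_cst.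
    by apply/funext => n; rewrite sg // mul0r.
  apply: cvg_near_cst; near=> n.
  rewrite indicE memNset ?mulr0 //= in_itv /=; apply/negP; rewrite -ltNge.
  near: n; move/cvgrPdist_lt : yc => /(_ _ z0); apply: filterS => k.
  by rewrite sub0r normrN; apply: le_lt_trans; exact: ler_norm.
- exact: L1_norm.
- by move=> n z; rewrite normrM ler_piMr // indicE; case: (_ \in _); rewrite ?normr1 ?normr0.
Unshelve. all: by end_near. Qed.

(** The test function is a difference of two [tent_primitive]s, based at [y] and at [x]. As the
    width shrinks, its derivative approximates the difference of the Dirac masses at [y] and [x],
    and the function itself the indicator of []y, x]]. *)
Lemma weak_derivative_increment (psi g : R -> R) (y x : R) :
  L1_pos psi -> L1_pos g -> weak_derivative psi g ->
  (forall z : R, 0 < z -> {for z, continuous psi}) -> 0 < y -> y < x ->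
  psi x - psi y = prim (g \_ `]0, +oo[) x - prim (g \_ `]0, +oo[) y.
Proof.
move=> psii gi wd cpsi y0 yx; have x0 : 0 < x by lra.
set g0 := g \_ _; pose psi0 := psi \_ `]0, +oo[.
have g0i : L1 mu g0 by exact: L1_restrict.
have mg0 : measurable_fun [set: R] g0 by exact: L1_measurable g0i.
have p0i : L1 mu psi0 by exact: L1_restrict.
pose e n : R := 1 / n.+1%:R.
have e0 n : 0 < e n by rewrite divr_gt0.
have ec : e n @[n --> \oo] --> 0 by exact: invS_cvg0.
pose phi n z := tent_primitive (e n) y z - tent_primitive (e n) x z.
have dphi n (z : R) : is_derive z 1 (phi n) (tent (e n) y z - tent (e n) x z).
  have d1 := is_derive_tent y z (e0 n); have d2 := is_derive_tent x z (e0 n).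
  exact: is_deriveB.
have d1phi n : derive1 (phi n) = fun z => tent (e n) y z - tent (e n) x z.
  by apply/funext => z; rewrite derive1E; have d := dphi n z; rewrite derive_val.
have tphi n : test_function (phi n).
  split.
  - by move=> z; have d := dphi n z; exact: ex_derive.
  - by rewrite d1phi => z; apply: cvgB; exact: continuous_tent.
  - exists y, (x + 2 * e n); split => // z zo; rewrite /phi.
    have en := e0 n.
    have [zy|yz] := leP z y.
      by rewrite !tent_primitive_le ?subrr // ltW // (le_lt_trans zy).
    have [zx|xz] := leP z (x + 2 * e n); first by case: zo; rewrite zx (ltW yz).
    by rewrite !tent_primitive_ge ?subrr //; lra.
have phi01 n z : `|phi n z| <= 1.
  have /andP[h1 h2] := tent_primitive_01 y z (e0 n).
  have /andP[h3 h4] := tent_primitive_01 x z (e0 n).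
  by rewrite /phi ler_norml; apply/andP; split; lra.
have mphi n : measurable_fun [set: R] (phi n).
  apply: continuous_measurable_fun => z; have d := dphi n z.
  by apply: differentiable_continuous; apply/derivable1_diffP; exact: ex_derive.
have main n : \int[mu]_z (psi0 z * tent (e n) y z) - \int[mu]_z (psi0 z * tent (e n) x z) =
    - \int[mu]_z (g0 z * phi n z).
  have := wd _ (tphi n); rewrite d1phi [X in X = _]Rintegral_mkcond [X in _ = -
    X]Rintegral_mkcond => h.
  transitivity (\int[mu]_z ((fun x0 : R => psi x0 * (tent (e n) y x0 - tent (e n) x x0)) \_
    `]0, +oo[) z).
    rewrite -RintegralB //; [|exact: L1_tent_mul..].
    apply: eq_Rintegral => z _; rewrite /psi0 !patchE; case: ifP => _; last by rewrite !mul0r subrr.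
    by rewrite mulrBr.
  rewrite h; congr (- _); apply: eq_Rintegral => z _.
  by rewrite /g0 !patchE; case: ifP; rewrite ?mul0r.
have lim1 : \int[mu]_z (psi0 z * tent (e n) y z) - \int[mu]_z (psi0 z * tent (e n) x z)
    @[n --> \oo] --> psi0 y - psi0 x.
  have cp0 (z : R) : 0 < z -> psi0 w @[w --> z] --> psi0 z.
    move=> z0; rewrite {2}/psi0 (restrict_pos psi z0).
    apply: cvg_trans (cpsi _ z0); apply: near_eq_cvg; near=> w.
    by rewrite [RHS](restrict_pos psi) //; near: w; exact: lt_nbhsr.
  by apply: cvgB; apply: Rintegral_tent_mul_cvg => //; exact: cp0.
have lim2 : (- \int[mu]_z (g0 z * phi n z)) @[n --> \oo] -->
    (- \int[mu]_z (g0 z * ((y < z)%R%:R - (x < z)%R%:R))).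
  apply: cvgN; apply: (@Rdominated_cvg _ _ _ mu (fun n z => g0 z * phi n z) _ (fun z => `|g0 z|)).
  - by move=> n; apply: measurable_funM; [exact: mg0|exact: mphi].
  - apply: (@measurable_fun_cvg _ _ _ _ (fun n z => g0 z * phi n z)).
      by move=> n; apply: measurable_funM; [exact: mg0|exact: mphi].
    move=> z _; apply: cvgM; first exact: cvg_cst.
    by apply: cvgB; exact: tent_primitive_cvg.
  - apply: aeW => z; apply: cvgM; first exact: cvg_cst.
    by apply: cvgB; exact: tent_primitive_cvg.
  - exact: L1_norm.
  - by move=> n z; rewrite normrM ler_piMr.
have h : psi0 y - psi0 x = - \int[mu]_z (g0 z * ((y < z)%R%:R - (x < z)%R%:R)).
  move/cvg_lim : lim1 => <- //; move/cvg_lim : lim2 => <- //.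
  by congr (lim (_ @ \oo)); apply/funext => n; exact: main.
rewrite -(restrict_pos psi x0) -(restrict_pos psi y0) -/psi0.
have {h} -> : psi0 x - psi0 y = \int[mu]_z (g0 z * ((y < z)%R%:R - (x < z)%R%:R)).
  by rewrite -[RHS]opprK -h opprB.
rewrite !primE -RintegralB //.
- apply: eq_Rintegral => z _; rewrite -mulrBr; congr (_ * _).
  by rewrite !indicE !mem_setE !in_itv /= !leNgt; case: (y < z); case: (x < z);
    rewrite /= ?subrr ?subr0 ?sub0r.
- exact: L1_indic_mul.
- exact: L1_indic_mul.
Unshelve. all: by end_near. Qed.

(** The increment formula holds between positive points; letting the lower one decrease to 0 uses
    the right continuity of [psi] at 0 and [psi 0 = 0]. *)
Lemma W11_0_prim (psi : R -> R) : W11_0 psi -> exists g,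
  [/\ L1 mu g, pos_supp g, L1 mu (psi \_ `]0, +oo[) &
     forall x, 0 <= x -> psi x = prim g x].
Proof.
move=> [[psii [g gi wd]] cpsi psi0].
have [cp cp0] : (forall z : R, 0 < z -> {for z, continuous psi}) /\ psi z @[z --> 0^'+] --> psi 0.
  move/continuous_within_itvcyP : cpsi => [c c0]; split => // z z0.
  by apply: c; rewrite in_itv /= andbT.
have g0i : L1 mu (g \_ `]0, +oo[) by exact: L1_restrict.
have sg0 := @pos_supp_restrict g.
exists (g \_ `]0, +oo[); split => //; first exact: L1_restrict.
have prim0 : prim (g \_ `]0, +oo[) 0 = 0.
  rewrite primE -[RHS](mul0r (fine (mu setT))) -Rintegral_cst //.
  apply: eq_Rintegral => z _; have [z0|z0] := leP z 0; first by rewrite sg0 ?mul0r.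
  by rewrite indicE memNset ?mulr0 //= in_itv /= leNgt z0.
move=> x; rewrite le_eqVlt => /predU1P[<-|x0]; first by rewrite prim0.
pose y n : R := (x / 2) / n.+1%:R.
have y0 n : 0 < y n by rewrite !divr_gt0.
have yx n : y n < x.
  apply: (@le_lt_trans _ _ (x / 2)); last by lra.
  by rewrite /y ler_pdivrMr // ler_peMr ?ler1n // ltW // divr_gt0.
have yc : y n @[n --> \oo] --> 0 by exact: invS_cvg0.
have lim1 : psi x - psi (y n) @[n --> \oo] --> psi x - psi 0.
  apply: cvgB; first exact: cvg_cst.
  move/cvg_at_rightP : cp0; apply; split => // n; exact: y0.
have lim2 : psi x - psi (y n) @[n --> \oo] --> prim (g \_ `]0, +oo[) x - 0.
  rewrite (_ : (fun n => _) = fun n => prim (g \_ `]0, +oo[) x - prim (g \_ `]0, +oo[) (y n)).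
    by apply: cvgB; [exact: cvg_cst|exact: prim_cvg0].
  by apply/funext => n; exact: weak_derivative_increment.
transitivity (psi x - psi 0); first by rewrite psi0 subr0.
transitivity (prim (g \_ `]0, +oo[) x - 0); last by rewrite subr0.
by move/cvg_lim : lim1 => <- //; move/cvg_lim : lim2 => <-.
Qed.

End sobolev.

(** * The Riemann-Liouville operator as a convolution *)

Section RL_operator_on_primitives.
Context {R : realType}.
Local Notation mu := (@lebesgue_measure R).
Variables (a b : R).
Hypotheses (a0 : 0 < a) (b0 : 0 < b).
Local Notation p := (pos_levy_tail a b).
Local Notation Phi := (gamma_exponent a b).

Lemma prim_le0 (g : R -> R) (x : R) : pos_supp g -> x <= 0 -> prim g x = 0.
Proof.
move=> sg x0; rewrite primE -[RHS](mul0r (fine (mu setT))) -Rintegral_cst //.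
apply: eq_Rintegral => z _; have [z0|z0] := leP z 0; first by rewrite sg ?mul0r.
by rewrite indicE memNset ?mulr0 //= in_itv /= leNgt (le_lt_trans x0).
Qed.

(** [prim g] is the convolution of [g] with the Heaviside function, which is not integrable. The
    exponential weight distributes over the two factors of the convolution and makes both
    integrable. *)
Lemma lap_prim (g : R -> R) (l : R) : L1 mu g -> pos_supp g -> 0 < l ->
  lap l g = l * lap l (prim g).
Proof.
move=> gi sg l0; have eg := L1_exp (ltW l0) gi sg; have hi := L1_exp_pos l0.
have mg := L1_measurable gi; have me := measurable_exp l.
have -> : lap l (prim g) = l^-1 * lap l g.
  rewrite -(Rintegral_exp_pos l0) -(Rintegral_conv hi eg).
  apply: eq_Rintegral => x _; rewrite /conv.
  have -> : prim g x = \int[mu]_y (g y * \1_`]-oo, x[ y).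
    under eq_Rintegral do rewrite mulrC.
    rewrite Rintegral_indic_mul /prim /Rintegral integral_itv_bndo_bndc //.
    by apply/measurable_EFinP; exact: measurable_funTS.
  rewrite -Rintegral_scale //; last by apply: measurable_funM => //; exact: measurable_indic.
  apply: eq_Rintegral => y _.
  rewrite !indicE !mem_setE !in_itv /= andbT subr_gt0.
  case: (y < x); last by rewrite !(mul0r, mulr0).
  rewrite mul1r mulr1 mulrA -expRD; congr (expR _ * _); ring.
by rewrite mulrA divff ?mul1r // gt_eqF.
Qed.

Lemma prim_conv (g k : R -> R) (z : R) : L1 mu g -> L1 mu k ->
  prim (conv g k) z = conv (prim g) k z.
Proof.
move=> gi ki; have mg := L1_measurable gi; have mk := L1_measurable ki.
pose F (s : R * R) := \1_`]-oo, z] s.1 * (g (s.1 - s.2) * k s.2).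
have m1 : measurable_fun setT (fun s : R * R => \1_`]-oo, z] s.1 : R).
  apply: (measurableT_comp (f := \1_`]-oo, z] : R -> R)); first exact: measurable_indic.
  exact: measurable_fst.
have LF : L1 (mu \x mu)%E F.
  apply: L1_le (L1_norm (L1_conv_kernel gi ki)).
    by apply: measurable_funM => //; exact: measurable_conv_kernel.
  by move=> s; rewrite normrM ler_piMl // indicE; case: (_ \in _); rewrite ?normr1 ?normr0.
have mgk x : measurable_fun [set: R] (fun y => g (x - y) * k y).
  by apply: measurable_funM => //; apply: (measurableT_comp mg); exact: measurable_funB.
transitivity (\int[mu]_x \int[mu]_y F (x, y)).
  rewrite primE; apply: eq_Rintegral => x _; rewrite mulrC /conv -Rintegral_scale //.
  exact: mgk.
rewrite (Rfubini LF) /conv; apply: eq_Rintegral => y _.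
rewrite primE mulrC -(@Rintegral_shift _ (fun u => g u * \1_`]-oo, z - y] u) y); last first.
  by apply: measurable_funM => //; exact: measurable_indic.
rewrite -Rintegral_scale //; last first.
  by apply: (@measurable_shift _ (fun u => g u * \1_`]-oo, z - y] u) y);
     apply: measurable_funM => //; exact: measurable_indic.
apply: eq_Rintegral => x _; rewrite /F /= !indicE !mem_setE !in_itv /= lerD2r.
ring.
Qed.

(** The integral under the derivative is [prim (conv g p)]. Lebesgue differentiation returns
    [conv g p] almost everywhere, which is all that a Laplace transform sees. *)
Lemma RL_operator_prim (psi g : R -> R) : L1 mu g -> pos_supp g -> L1 mu psi ->
  psi = prim g ->
  {ae mu, forall x, 0 < x -> RL_operator a b psi x = conv g p x}.
Proof.
move=> gi sg psii psiE; have pi := L1_pos_levy_tail a0 b0.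
have mp := L1_measurable pi.
have mpsi := L1_measurable psii.
have WE z : \int[mu]_(y in `[0, z]) (psi (z - y) * levy_tail a b y) = prim (conv g p) z.
  rewrite prim_conv // -psiE /conv.
  transitivity (\int[mu]_(y in `]0, z]) (psi (z - y) * p y)); last first.
    rewrite -Rintegral_indic_mul; apply: eq_Rintegral => y _.
    rewrite indicE mem_setE in_itv /=.
    have [y0|y0] /= := ltP 0 y; last by rewrite pos_supp_pos_levy_tail // mul0r mulr0.
    have [yz|yz] := leP y z; rewrite ?mul1r // mul0r psiE prim_le0 ?mul0r //.
    by rewrite subr_le0 ltW.
  have mI : measurable_fun (`]0, z]%classic : set R) (fun y => (psi (z - y) * p y)%:E).
    apply/measurable_EFinP; apply: measurable_funTS; apply: measurable_funM => //.
    by apply: (measurableT_comp mpsi); exact: measurable_funB.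
  have eqI : {in (`]0, z]%classic : set R), (fun y => (psi (z - y) * p y)%:E) =1
     (fun y => (psi (z - y) * levy_tail a b y)%:E)}.
    by move=> y; rewrite inE /= in_itv /= /pos_levy_tail => /andP[-> _].
  rewrite /Rintegral -integral_itv_obnd_cbnd.
    by congr fine; apply: eq_integral => y yi; rewrite -eqI.
  by apply: eq_measurable_fun mI.
have {}WE : (fun z => \int[mu]_(y in `[0, z]) (psi (z - y) * levy_tail a b y)) =
    prim (conv g p) by apply/funext.
apply: ae_impl (prim_derive1 (L1_conv gi pi)) _ => x [_ dk] x0.
by rewrite /RL_operator WE dk.
Qed.

End RL_operator_on_primitives.

(** * Uniqueness for the evolution equation *)

Section real_fatou.
Context {d : measure_display} {T : measurableType d} {R : realType}.
Variable mu : {measure set T -> \bar R}.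

(** The varying bounds [c_] serve two purposes: constant, they give the lower semicontinuity of the
    energy; tending to 0, they identify a pointwise limit with an [L1] limit. *)
Lemma Rfatou (f_ : nat -> T -> R) (f : T -> R) (c_ : nat -> R) (c : R) :
  (forall n, L1 mu (f_ n)) -> (forall n x, 0 <= f_ n x) ->
  (forall x, f_ n x @[n --> \oo] --> f x) ->
  (forall n, \int[mu]_x f_ n x <= c_ n) -> c_ n @[n --> \oo] --> c ->
  L1 mu f /\ \int[mu]_x f x <= c.
Proof.
move=> if_ f_0 ff fc cc.
have mf_ n := L1_measurable (if_ n).
have mf : measurable_fun [set: T] f by apply: (measurable_fun_cvg mf_).
have f0 x : 0 <= f x.
  have h := ff x; rewrite -(cvg_lim _ h) //; apply: limr_ge; first exact: cvgP h.
  by apply: nearW => n; exact: f_0.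
have lec : (\int[mu]_x (f x)%:E <= c%:E)%E.
  have -> : (\int[mu]_x (f x)%:E = \int[mu]_x limn_einf (fun n => (f_ n x)%:E))%E.
    apply: eq_integral => x _.
    have h : (f_ n x)%:E @[n --> \oo] --> (f x)%:E by apply: cvg_EFin; [exact: nearW|exact: ff].
    by rewrite (cvg_limn_einf_sup h).1.
  apply: le_trans (@fatou _ _ _ mu setT measurableT (fun n x => (f_ n x)%:E) _ _) _.
  - by move=> n; exact/measurable_EFinP.
  - by move=> n x _; rewrite lee_fin.
  have hc : (c_ n)%:E @[n --> \oo] --> c%:E by apply: cvg_EFin; [exact: nearW|exact: cc].
  rewrite -(cvg_limn_einf_sup hc).1.
  rewrite !limn_einf_lim; apply: lee_lim; [exact: is_cvg_einfs|exact: is_cvg_einfs|].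
  apply: nearW => n; apply: le_ereal_inf_tmp => _ [m /= nm <-].
  apply: (@le_trans _ _ (\int[mu]_x (f_ m x)%:E)%E).
    by apply: ereal_inf_lbound; exists m.
  by rewrite -EFin_Rintegral // lee_fin.
have fi : L1 mu f.
  apply/integrableP; split; first exact/measurable_EFinP.
  apply: le_lt_trans (ltry c); apply: le_trans lec; rewrite le_eqVlt; apply/orP; left; apply/eqP.
  by apply: eq_integral => x _; rewrite /= ger0_norm.
by split => //; rewrite -lee_fin EFin_Rintegral.
Qed.

Lemma Rintegral_norm_eq0 (f : T -> R) : L1 mu f -> \int[mu]_x `|f x| <= 0 ->
  {ae mu, forall x, f x = 0}.
Proof.
move=> fi f0; have mf := L1_measurable fi.
have : (\int[mu]_x `|(f x)%:E| = 0)%E.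
  rewrite -(EFin_Rintegral (L1_norm fi)); congr EFin; apply/eqP; rewrite eq_le f0 /=.
  exact: Rintegral_ge0.
have mF : measurable_fun [set: T] (EFin \o f) by exact/measurable_EFinP.
move/(ae_eq_integral_abs _ measurableT mF); apply: filterS => x /(_ I).
by case.
Qed.

Lemma measurable_nat_switch (n : T -> nat) (F : nat -> T -> R) :
  (forall j, measurable (n @^-1` [set j])) ->
  (forall j, measurable_fun [set: T] (F j)) ->
  measurable_fun [set: T] (fun x => F (n x) x).
Proof.
move=> mn mF _ Y mY; rewrite setTI.
rewrite (_ : _ @^-1` Y = \bigcup_j ((n @^-1` [set j]) `&` (F j @^-1` Y))); last first.
  by apply/seteqP; split => [x Yx|x [j _ [/= <-]]] //; exists (n x).
apply: bigcupT_measurable => j; apply: measurableI => //.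
by rewrite -[X in measurable X]setTI; exact: mF.
Qed.

End real_fatou.

(** * Joint measurability of separately regular functions *)

Section separately_continuous.
Context {R : realType}.
Local Notation mu := (@lebesgue_measure R).

Lemma measurable_truncn_preimage (c : R) (j : nat) :
  measurable [set s : R * R | Num.trunc (s.2 * c) = j].
Proof.
have m2 : measurable_fun setT (fun s : R * R => s.2 * c).
  by apply: measurable_funM => //; exact: measurable_snd.
(* [Num.trunc] is 0 on all negative numbers, so the fibre of 0 is the whole half-line below 1. *)
case: j => [|j].
  rewrite (_ : [set s | _] = (fun s : R * R => s.2 * c) @^-1` `]-oo, 1[).
    by rewrite -[X in measurable X]setTI; exact: m2.
  apply/seteqP; split => s /=; rewrite in_itv /= ltNge; first by move/truncn0Pn.
  by move=> s1; apply/truncn0Pn.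
rewrite (_ : [set s | _] = (fun s : R * R => s.2 * c) @^-1` `[j.+1%:R, j.+2%:R[).
  by rewrite -[X in measurable X]setTI; exact: m2.
apply/seteqP; split => s /=; rewrite in_itv /=.
  move=> h; have s1 : 1 <= s.2 * c by rewrite -truncn_gt0 h.
  by rewrite -truncn_eq ?h // (le_trans _ s1).
by move=> h; apply/eqP; rewrite truncn_eq //; apply: le_trans (andP h).1.
Qed.

Variable w : R -> R -> R.
Hypothesis w_cont_x : forall t x : R, 0 < t -> 0 < x -> {for x, continuous (w t)}.
Hypothesis w_C1 : forall x : R, 0 < x -> C1_pos (w ^~ x).

Definition pos_part2 (u : R -> R -> R) (s : R * R) : R :=
  if (0 < s.1) && (0 < s.2) then u s.1 s.2 else 0.

Lemma w_cont_t (t x : R) : 0 < t -> 0 < x -> {for t, continuous (w ^~ x)}.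
Proof.
move=> t0 x0; have [dt _] := w_C1 x0 t0.
by apply: differentiable_continuous; apply/derivable1_diffP.
Qed.

Let measurable_pos2 : measurable [set s : R * R | (0 < s.1) && (0 < s.2)].
Proof.
rewrite (_ : [set s | _] = (fst @^-1` `]0, +oo[) `&` (snd @^-1` `]0, +oo[)); last first.
  by apply/seteqP; split => s /=; rewrite !in_itv /= !andbT => /andP.
apply: measurableI; rewrite -[X in measurable X]setTI.
  exact: measurable_fst.
exact: measurable_snd.
Qed.

Let indic_pos2 (s : R * R) :
  \1_[set s : R * R | (0 < s.1) && (0 < s.2)] s = ((0 < s.1) && (0 < s.2))%R%:R :> R.
Proof. by rewrite indicE; congr (nat_of_bool _)%:R; apply/idP/idP; rewrite inE. Qed.

Lemma measurable_pos_part2 : measurable_fun setT (pos_part2 w).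
Proof.
pose idx (N : nat) (s : R * R) := Num.trunc (s.2 * N.+1%:R).
(* Right end of the [j]-th cell of a grid of mesh [1 / N.+1]: freezing [x] there leaves a function
   measurable in [t], and continuity in [x] gives the limit. Right ends are positive, where [w] is
   regular. *)
pose y (N j : nat) : R := j.+1%:R / N.+1%:R.
pose A (N : nat) (s : R * R) :=
  \1_[set s : R * R | (0 < s.1) && (0 < s.2)] s * ((w ^~ (y N (idx N s))) \_ `]0, +oo[) s.1.
apply: (@measurable_fun_cvg _ _ _ _ A) => [N|s _].
  apply: measurable_funM; first exact: measurable_indic.
  apply: (@measurable_nat_switch _ _ _ (idx N) (fun j s => ((w ^~ (y N j)) \_ `]0, +oo[) s.1)) => j.
    exact: measurable_truncn_preimage.
  apply: (measurableT_comp (f := (w ^~ (y N j)) \_ `]0, +oo[)); last exact: measurable_fst.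
  apply/(measurable_restrictT _ (measurable_itv _)).
  apply: open_continuous_measurable_fun => // t; rewrite inE /= in_itv /= andbT => t0.
  by apply: w_cont_t => //; rewrite /y divr_gt0.
rewrite /A /pos_part2 indic_pos2.
case: ifPn => [/andP[s1 s2]|_]; last first.
  by rewrite (_ : (fun N => _) = cst 0); [exact: cvg_cst|apply/funext => N; rewrite /= mul0r].
rewrite (_ : (fun N => _) = fun N => w s.1 (y N (idx N s))); last first.
  by apply/funext => N; rewrite mul1r restrict_pos.
have yc : y N (idx N s) @[N --> \oo] --> s.2.
  apply/cvgrPdist_le => e e0; near=> N.
  have N0 : 0 < N.+1%:R :> R by [].
  have := truncn_itv (mulr_ge0 (ltW s2) (ltW N0)).
  rewrite -/(idx N s) => /andP[h1 h2].
  have y1 : s.2 <= y N (idx N s) by rewrite /y ler_pdivlMr // ltW.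
  have y2 : y N (idx N s) <= s.2 + 1 / N.+1%:R.
    by rewrite /y ler_pdivrMr // mulrDl divfK ?gt_eqF // -natr1 lerD2r.
  rewrite ler0_norm ?subr_le0 // opprB.
  apply: (@le_trans _ _ (1 / N.+1%:R)); first by rewrite lerBlDl.
  near: N; have := @invS_cvg0 R 1; move/cvgrPdist_le => /(_ _ e0).
  by apply: filterS => N; rewrite sub0r normrN; apply: le_trans; exact: ler_norm.
exact: (cvg_comp _ _ yc (w_cont_x s1 s2)).
Unshelve. all: by end_near. Qed.

(** A limit of forward difference quotients; positive steps keep the time in []0, +oo[]. *)
Lemma measurable_pos_part2_derive :
  measurable_fun setT (pos_part2 (fun t x => derive1 (w ^~ x) t)).
Proof.
pose A (n : nat) (s : R * R) := \1_[set s : R * R | (0 < s.1) && (0 < s.2)] s *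
  (n.+1%:R * (pos_part2 w (s.1 + n.+1%:R^-1, s.2) - pos_part2 w s)).
apply: (@measurable_fun_cvg _ _ _ _ A) => [n|s _].
  apply: measurable_funM; first exact: measurable_indic.
  apply: measurable_funM => //; apply: measurable_funB; last exact: measurable_pos_part2.
  apply: (measurableT_comp measurable_pos_part2).
  apply: measurable_fun_pair; last exact: measurable_snd.
  by apply: measurable_funD => //; exact: measurable_fst.
rewrite /A indic_pos2 /pos_part2.
case: ifPn => [/andP[s1 s2]|_]; last first.
  by rewrite (_ : (fun N => _) = cst 0); [exact: cvg_cst|apply/funext => N; rewrite /= mul0r].
have [dw _] := w_C1 s2 s1.
rewrite (_ : (fun n => _) = fun n => n.+1%:R * (w (s.1 + n.+1%:R^-1) s.2 - w s.1 s.2)); last first.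
  by apply/funext => n /=; rewrite mul1r s2 addr_gt0 ?invr_gt0.
have /cvg_dnbhs_at_right/cvg_at_rightP dr := dw.
have := dr (fun n => n.+1%:R^-1); rewrite -/(derive (w ^~ s.2) s.1 1) -derive1E.
rewrite (_ : (fun n => _ *: _) = fun n => n.+1%:R * (w (s.1 + n.+1%:R^-1) s.2 - w s.1 s.2)).
  by apply; split; [move=> n; rewrite invr_gt0|exact: cvg_harmonic].
by apply/funext => n; rewrite invrK /= [_ *: 1]mulr1 [_ + s.1]addrC.
Qed.

End separately_continuous.

(** * The exponential law and local boundedness of the energy *)

Section evolution.
Context {R : realType}.
Local Notation mu := (@lebesgue_measure R).
Variables (a b : R).
Hypotheses (a0 : 0 < a) (b0 : 0 < b).
Local Notation Phi := (gamma_exponent a b).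
Local Notation gam := (gamma_density a b).

Variable w : R -> R -> R.
Hypothesis w_L1 : forall t : R, 0 < t -> L1 mu (w t).
Hypothesis w_supp : forall t : R, 0 < t -> pos_supp (w t).
Hypothesis w_cont_x : forall t x : R, 0 < t -> 0 < x -> {for x, continuous (w t)}.
Hypothesis w_C1 : forall x : R, 0 < x -> C1_pos (w ^~ x).

Definition time_derivative (t x : R) : R := if 0 < x then derive1 (w ^~ x) t else 0.
Local Notation D := time_derivative.

Hypothesis D_L1 : forall t : R, 0 < t -> L1 mu (D t).
Hypothesis lap_D : forall t l : R, 0 < t -> 0 < l -> lap l (D t) = - Phi l * lap l (w t).
(** [g] is the [x]-derivative of [w t], seen through its transform; it supplies the extra unit of
    shape in [evolves_left_limit]. *)
Hypothesis w_prim : forall t : R, 0 < t -> exists2 g : R -> R, L1 mu g /\ pos_supp g &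
  forall l : R, 0 < l -> lap l g = l * lap l (w t).

Lemma D_supp t : pos_supp (D t).
Proof. by move=> x x0; rewrite /D ltNge x0. Qed.

Definition evolves (s t : R) : Prop :=
  forall l : R, 0 < l -> lap l (w t) = expR (- ((t - s) * Phi l)) * lap l (w s).

(* Finite at each time, but nothing in the hypotheses makes it locally bounded. *)
Definition energy (t : R) : R := \int[mu]_x (`|D t x| + `|w t x|).

Lemma evolves_trans s r t : evolves s r -> evolves r t -> evolves s t.
Proof.
move=> sr rt l l0; rewrite rt // sr // mulrA -expRD; congr (expR _ * _); ring.
Qed.

Lemma energy_split t : 0 < t ->
  energy t = \int[mu]_x `|D t x| + \int[mu]_x `|w t x|.
Proof. by move=> t0; rewrite /energy RintegralD //; apply: L1_norm; [exact: D_L1|exact: w_L1]. Qed.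

Lemma energy_ge0 t : 0 <= energy t.
Proof. by apply: Rintegral_ge0 => x _; rewrite addr_ge0. Qed.

Lemma energy_lsc (s : nat -> R) (t N : R) : 0 < t -> (forall n, 0 < s n) ->
  s n @[n --> \oo] --> t -> (forall n, energy (s n) <= N) -> energy t <= N.
Proof.
move=> t0 s0 sc sN.
suff [] : L1 mu (fun x => `|D t x| + `|w t x|) /\ energy t <= N by [].
apply: (@Rfatou _ _ _ mu (fun n x => `|D (s n) x| + `|w (s n) x|) _ (fun=> N)).
- by move=> n; apply: L1D; apply: L1_norm; [exact: D_L1|exact: w_L1].
- by move=> n x; rewrite addr_ge0.
- move=> x; have [x0|x0] := leP x 0.
    rewrite D_supp // w_supp //.
    rewrite (_ : (fun n => _) = cst (`|0 : R| + `|0 : R|)); first exact: cvg_cst.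
    by apply/funext => n; rewrite D_supp // w_supp.
  apply: cvgD; apply: cvg_norm.
    rewrite /D x0; have [_ dc] := w_C1 x0 t0.
    exact: (cvg_comp _ _ sc dc).
  exact: (cvg_comp _ _ sc (w_cont_t w_C1 t0 x0)).
- exact: sN.
- exact: cvg_cst.
Qed.

(** Fubini for [F], which is [expR (- (l * x))] times the [r]-derivative of
    [expR (r * phi) * w r x]. The integral in [x] is 0 by [lap_D]; the integral in [r] is the
    increment between [s] and [t]. The bound on the energy makes [F] integrable on the strip. *)
Lemma evolves_of_bounded (s t N : R) : 0 < s -> s <= t ->
  (forall r, s <= r <= t -> energy r <= N) -> evolves s t.
Proof.
move=> s0; rewrite le_eqVlt => /predU1P[<- _ l l0|st rN l l0].
  by rewrite subrr mul0r oppr0 expR0 mul1r.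
set phi := Phi l; have phi0 : 0 <= phi by exact: Phi_ge0 (ltW l0).
pose F (q : R * R) : R := \1_`[s, t] q.1 * expR (- (l * q.2)) *
  (expR (q.1 * phi) * (phi * pos_part2 w q + pos_part2 (fun t x => derive1 (w ^~ x) t) q)).
have FE r x : s <= r <= t ->
    F (r, x) = expR (- (l * x)) * (expR (r * phi) * (phi * w r x + D r x)).
  move=> rst; have r0 : 0 < r by case/andP: rst => sr _; exact: lt_le_trans sr.
  rewrite /F /pos_part2 /= r0 indicE mem_set /= ?in_itv //= mul1r /D.
  by have [//|x0] := ltP 0 x; rewrite w_supp.
have F0 r x : ~~ (s <= r <= t) -> F (r, x) = 0.
  by move=> rst; rewrite /F indicE memNset /= ?in_itv ?mul0r //; exact/negP.
have mF : measurable_fun setT F.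
  apply: measurable_funM.
    apply: measurable_funM.
      apply: (measurableT_comp (f := \1_`[s, t] : R -> R)); first exact: measurable_indic.
      exact: measurable_fst.
    by apply: (measurableT_comp (measurable_exp l)); exact: measurable_snd.
  apply: measurable_funM.
    apply: (measurableT_comp (f := expR)); first exact: measurable_expR.
    by apply: measurable_funM => //; exact: measurable_fst.
  apply: measurable_funD; last exact: measurable_pos_part2_derive.
  by apply: measurable_funM => //; exact: measurable_pos_part2.
pose C := expR (t * phi) * (phi + 1).
have C0 : 0 <= C by rewrite mulr_ge0 ?expR_ge0 // addr_ge0.
have Fle r x : s <= r <= t -> `|F (r, x)| <= C * (`|D r x| + `|w r x|).
  move=> rst; have /andP[sr rt] := rst; have r0 : 0 < r by exact: lt_le_trans sr.
  rewrite FE //; have [x0|x0] := leP x 0.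
    by rewrite D_supp // w_supp // !mulr0 addr0 !mulr0 normr0 addr0 mulr0.
  rewrite normrM ger0_norm ?expR_ge0 //.
  apply: (@le_trans _ _ `|expR (r * phi) * (phi * w r x + D r x)|).
    rewrite ler_piMl // -expR0 ler_expR oppr_le0 mulr_ge0 // ltW //.
  rewrite normrM ger0_norm ?expR_ge0 // /C -mulrA; apply: ler_pM; rewrite ?expR_ge0 //.
    by rewrite ler_expR ler_wpM2r.
  apply: le_trans (ler_normD _ _) _; rewrite normrM (ger0_norm phi0).
  have := normr_ge0 (D r x); have := normr_ge0 (w r x); nra.
have N0 : 0 <= N by apply: le_trans (energy_ge0 s) (rN s _); rewrite lexx ltW.
have LF : L1 (mu \x mu)%E F.
  apply/integrable12ltyP; first exact/measurable_EFinP.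
  have Li : L1 mu (fun r => C * N * \1_`[s, t] r).
    by apply: L1Z; exact: integrable_indic_itv.
  apply: (@le_lt_trans _ _ (\int[mu]_r (C * N * \1_`[s, t] r)%:E)%E); last first.
    by rewrite -EFin_Rintegral // ltry.
  apply: ge0_le_integral => //.
  - by move=> r _; apply: integral_ge0.
  - apply: (@measurable_fun_fubini_tonelli_F _ _ _ _ _ mu (fun q => `|(F q)%:E|%E)) => //.
    by apply: measurableT_comp => //; exact/measurable_EFinP.
  - exact: measurable_int Li.
  - move=> r _; have [rst|rst] := boolP (s <= r <= t); last first.
      under eq_integral => x _ do rewrite /= F0 // normr0.
      by rewrite integral0 lee_fin mulr_ge0 // mulr_ge0.
    have r0 : 0 < r by case/andP: rst => sr _; exact: lt_le_trans sr.
    have Le : L1 mu (fun x => `|D r x| + `|w r x|).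
      by apply: L1D; apply: L1_norm; [exact: D_L1|exact: w_L1].
    rewrite indicE mem_set /= ?in_itv //= mulr1.
    apply: (@le_trans _ _ (\int[mu]_x (C * (`|D r x| + `|w r x|))%:E)%E).
      apply: ge0_le_integral => //.
      + apply/measurable_EFinP; apply: (measurableT_comp (f := fun x : R => `|x|)) => //.
        exact: (measurable_fun_pair2 r mF).
      + exact: measurable_int (L1Z C Le).
      + by move=> x _; rewrite lee_fin Fle.
    rewrite -(EFin_Rintegral (L1Z C Le)) lee_fin Rintegral_scale //; last exact: L1_measurable Le.
    by rewrite ler_wpM2l // rN.
have int0 : \int[mu]_r \int[mu]_x F (r, x) = 0.
  rewrite -[RHS](mul0r (fine (mu setT))) -Rintegral_cst //; apply: eq_Rintegral => r _.
  have [rst|rst] := boolP (s <= r <= t); last first.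
    under eq_Rintegral => x _ do rewrite F0 //.
    by rewrite Rintegral_cst // mul0r.
  have r0 : 0 < r by case/andP: rst => sr _; exact: lt_le_trans sr.
  under eq_Rintegral => x _ do rewrite FE // mulrCA.
  have Lw := w_L1 r0; have LD := D_L1 r0.
  have Lwe : L1 mu (fun x => phi * w r x) by exact: L1Z.
  have sw : pos_supp (fun x => phi * w r x) by move=> x x0; rewrite w_supp // mulr0.
  have h := lapD (ltW l0) Lwe LD sw (@D_supp r).
  rewrite Rintegral_scale //; last first.
    apply: measurable_funM; first exact: measurable_exp.
    exact: L1_measurable (L1D Lwe LD).
  by rewrite -/(lap l _) h lapZ // lap_D // mulNr subrr mulr0.
have FTC x : \int[mu]_r F (r, x) = expR (- (l * x)) * (expR (t * phi) * w t x - expR (s * phi)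
  * w s x).
  have [x0|x0] := leP x 0.
    rewrite !w_supp // ?(lt_trans s0 st) // !mulr0 subrr mulr0.
    rewrite -[RHS](mul0r (fine (mu setT))) -Rintegral_cst //; apply: eq_Rintegral => r _.
    have [rst|rst] := boolP (s <= r <= t); last by rewrite F0.
    have r0 : 0 < r by case/andP: rst => sr _; exact: lt_le_trans sr.
    by rewrite FE // w_supp // D_supp // !mulr0 addr0 !mulr0.
  pose f r := expR (r * phi) * (phi * w r x + derive1 (w ^~ x) r).
  pose G r := expR (r * phi) * w r x.
  have pos r : s <= r <= t -> 0 < r by move=> /andP[sr _]; exact: lt_le_trans sr.
  have dE (r : R) : is_derive r 1 (fun r => expR (r * phi)) (phi * expR (r * phi)).
    have := is_derive_exp (- phi) r; rewrite opprK.
    rewrite (_ : (fun y => _) = fun r => expR (r * phi)).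
      by move=> h; apply: is_derive_eq h _; congr (_ * expR _); ring.
    by apply/funext => y; congr expR; ring.
  have dG (r : R) : s <= r <= t -> is_derive r 1 G (f r).
    move=> /pos r0; have dw : is_derive r 1 (w ^~ x) (derive1 (w ^~ x) r).
      by have [dw _] := w_C1 x0 r0; rewrite derive1E; exact/derivableP.
    have := is_deriveM (dE r) dw => h; apply: is_derive_eq h _.
    rewrite /f -[_ *: _ + _]/(expR (r * phi) * derive1 (w ^~ x) r + w r x * (phi * expR (r *
      phi))); ring.
  have cf (r : R) : s <= r <= t -> {for r, continuous f}.
    move=> /pos r0; have [_ dc] := w_C1 x0 r0.
    have ce : {for r, continuous (fun r : R => expR (r * phi))}.
      by apply: differentiable_continuous; apply/derivable1_diffP; have := dE r => ?;
        exact: ex_derive.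
    apply: cvgM; first exact: ce.
    apply: cvgD; last exact: dc.
    by apply: cvgM; [exact: cvg_cst|exact: w_cont_t].
  transitivity (expR (- (l * x)) * \int[mu]_(r in `[s, t]) f r).
    have fE r : F (r, x) = expR (- (l * x)) * (\1_`[s, t] r * f r).
      rewrite indicE mem_setE in_itv /=.
      have [rst|rst] := boolP (s <= r <= t); last by rewrite F0 // mul0r mulr0.
      by rewrite FE // mul1r /D x0.
    under eq_Rintegral => r _ do rewrite fE.
    rewrite Rintegral_scale ?Rintegral_indic_mul //.
    rewrite (_ : (fun r => _) = fun r => expR (l * x) * F (r, x)).
      apply: measurable_funM => //; exact: (measurable_fun_pair1 x mF).
    by apply/funext => r; rewrite fE mulrA -expRD subrr expR0 mul1r.
  by rewrite /Rintegral (FTC2_is_derive st cf dG).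
have t0 : 0 < t := lt_trans s0 st.
have Lt := w_L1 t0; have Ls := w_L1 s0.
have st' : pos_supp (fun x => expR (t * phi) * w t x) by move=> x x0; rewrite w_supp // mulr0.
have ss' : pos_supp (fun x => expR (s * phi) * w s x) by move=> x x0; rewrite w_supp // mulr0.
have := lapB (ltW l0) (L1Z (expR (t * phi)) Lt) (L1Z (expR (s * phi)) Ls) st' ss'.
have -> : lap l (fun x => expR (t * phi) * w t x - expR (s * phi) * w s x) = 0.
  rewrite -int0 (Rfubini LF); apply: eq_Rintegral => x _.
  by rewrite /= FTC.
rewrite !lapZ // => /esym/eqP; rewrite subr_eq0 => /eqP h.
have -> : - ((t - s) * phi) = - (t * phi) + s * phi by ring.
by rewrite expRD -mulrA -h mulrA -expRD addNr expR0 mul1r.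
Qed.

Lemma evolves_conv (f h : R -> R) (u : R) : 0 < u -> L1 mu f -> pos_supp f ->
  L1 mu h -> pos_supp h ->
  (forall l : R, 0 < l -> lap l h = expR (- (u * Phi l)) * lap l f) ->
  {ae mu, forall x, h x = conv (gam u) f x}.
Proof.
move=> u0 fi sf hi sh lh; have gi := L1_gamma_density a0 b0 u0.
have sg := @pos_supp_gamma_density _ a b u.
apply: lerch => //; [exact: L1_conv|exact: pos_supp_conv|].
move=> l l0; rewrite lh // lap_conv ?(ltW l0) //.
by rewrite lap_gamma_density ?(ltW l0).
Qed.

Lemma evolves_norm_le (f h : R -> R) (u : R) : 0 < u -> L1 mu f -> pos_supp f ->
  L1 mu h -> pos_supp h ->
  (forall l : R, 0 < l -> lap l h = expR (- (u * Phi l)) * lap l f) ->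
  \int[mu]_x `|h x| <= \int[mu]_x `|f x|.
Proof.
move=> u0 fi sf hi sh lh; have gi := L1_gamma_density a0 b0 u0.
have hE := evolves_conv u0 fi sf hi sh lh.
have ci := L1_conv gi fi.
rewrite (@ae_eq_Rintegral _ _ _ mu _ (fun x => `|conv (gam u) f x|)); last first.
- by apply: ae_impl hE _ => x ->.
- exact: L1_measurable (L1_norm ci).
- exact: L1_measurable (L1_norm hi).
apply: le_trans (Rintegral_norm_conv gi fi) _.
have -> : \int[mu]_x `|gam u x| = 1.
  rewrite -(Rintegral_gamma_density a0 b0 u0); apply: eq_Rintegral => x _.
  by rewrite ger0_norm // gamma_density_ge0.
by rewrite mul1r.
Qed.

(** The factor [- Phi l] in [lap_D] does not depend on time, so the time derivative follows the same
    law as [w], and [evolves_norm_le] applies to both. *)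
Lemma evolves_energy (s t : R) : 0 < s -> s <= t -> evolves s t -> energy t <= energy s.
Proof.
move=> s0; rewrite le_eqVlt => /predU1P[-> _|st est]; first exact: lexx.
have t0 : 0 < t := lt_trans s0 st; have ts0 : 0 < t - s by rewrite subr_gt0.
rewrite !energy_split //; apply: lerD; apply: (evolves_norm_le ts0).
- exact: D_L1.
- exact: D_supp.
- exact: D_L1.
- exact: D_supp.
- by move=> l l0; rewrite !lap_D // est // mulrCA.
- exact: w_L1.
- exact: w_supp.
- exact: w_L1.
- exact: w_supp.
- exact: est.
Qed.

Lemma conv_subl (f h k : R -> R) : L1 mu f -> L1 mu h -> L1 mu k ->
  {ae mu, forall x, conv f k x - conv h k x = conv (fun y => f y - h y) k x}.
Proof.
move=> fi hi ki.
have := ae_integrable1 (L1_conv_kernel fi ki); have := ae_integrable1 (L1_conv_kernel hi ki).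
move=> h1 h2; apply: ae_impl2 h1 h2 _ => x hx fx.
rewrite /conv -RintegralB //; apply: eq_Rintegral => y _; ring.
Qed.

(* On the Laplace side [w s] is [(1 + l / b) ^ (a * (t - s))] times [w t], and
   for [a * (t - s) < 1] this is the transform of a gamma density against
   [w t + g / b], with [g] the derivative of [w t]; hence [w s] converges in
   [L1] as [s] decreases to [al]. *)
Lemma evolves_left_limit (al t : R) (u : R -> R) : 0 <= al -> al < t -> a * (t - al) < 1 ->
  (forall s : R, al < s -> s < t -> evolves s t) ->
  (forall x : R, 0 < x -> w s x @[s --> al^'+] --> u x) -> pos_supp u ->
  L1 mu u /\ forall l : R, 0 < l -> lap l (w t) = expR (- ((t - al) * Phi l)) * lap l u.
Proof.
move=> al0 alt at1 est wu su; have t0 : 0 < t by exact: le_lt_trans alt.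
have [g [gi sg] lg] := w_prim t0.
pose G x := w t x + b^-1 * g x.
have Gi : L1 mu G by apply: L1D; [exact: w_L1|exact: L1Z].
have sG : pos_supp G by move=> x x0; rewrite /G w_supp // sg // mulr0 addr0.
have lG (l : R) : 0 < l -> lap l G = (1 + l / b) * lap l (w t).
  move=> l0; rewrite lapD ?(ltW l0) ?lapZ ?lg //; [ring|exact: w_L1|exact: L1Z|exact: w_supp|].
  by move=> x x0; rewrite sg // mulr0.
have ePhi (l : R) : 0 < l -> 1 + l / b = expR (a^-1 * Phi l).
  move=> l0; rewrite /gamma_exponent mulrA mulVf ?gt_eqF // mul1r lnK // posrE.
  by rewrite addr_gt0 // divr_gt0.
(* [a^-1] is the time at which the gamma density has shape 1 and transform [(1 + l / b)^-1]. What is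
   left of it after going back from [t] to [s] is positive because [a * (t - al) < 1]. *)
pose tau s := a^-1 - (t - s).
have tau0 s : al <= s -> 0 < tau s.
  move=> als; rewrite subr_gt0; apply: (@le_lt_trans _ _ (t - al)); first by rewrite lerB.
  by rewrite -[a^-1]mul1r ltr_pdivlMr // mulrC.
pose n := conv (gam (tau al)) G.
have gamL1 s : al <= s -> L1 mu (gam (tau s)) by move=> als; exact: L1_gamma_density (tau0 _ als).
have ni : L1 mu n by apply: L1_conv => //; exact: gamL1.
have sn : pos_supp n by apply: pos_supp_conv => //; exact: pos_supp_gamma_density.
have wE s : al < s -> s < t -> {ae mu, forall x, w s x = conv (gam (tau s)) G x}.
  move=> als st; have s0 : 0 < s by exact: le_lt_trans als.
  apply: evolves_conv => //; [exact: tau0 (ltW als)|exact: w_L1|exact: w_supp|].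
  move=> l l0; rewrite lG // ePhi // (est s als st l l0) !mulrA -!expRD.
  rewrite -[LHS]mul1r -[X in X * _ = _]expR0; congr (expR _ * _); rewrite /tau; ring.
pose s_ (k : nat) : R := al + (t - al) / 2 / k.+1%:R.
have tal : 0 < (t - al) / 2 by rewrite divr_gt0 // subr_gt0.
have als k : al < s_ k by rewrite ltrDl divr_gt0.
have st k : s_ k < t.
  apply: (@le_lt_trans _ _ (al + (t - al) / 2)); last by lra.
  by rewrite lerD2l ler_pdivrMr // ler_peMr ?ler1n // ltW.
have sc : s_ k @[k --> \oo] --> al.
  rewrite -[X in _ --> X]addr0; apply: cvgD; first exact: cvg_cst.
  exact: invS_cvg0.
have tauc : tau (s_ k) @[k --> \oo] --> tau al.
  by apply: cvgB; [exact: cvg_cst|apply: cvgB; [exact: cvg_cst|exact: sc]].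
have gc : \int[mu]_x `|gam (tau (s_ k)) x - gam (tau al) x| @[k --> \oo] --> 0.
  apply: (@gamma_density_cvg_L1 _ a b a0 b0 _ (tau al) (tau t)) => //; [exact: tau0| |exact: tau0].
  by move=> k; rewrite /tau; apply/andP; split; rewrite lerD2l lerN2 lerD2l lerN2 ltW.
pose c_ k := \int[mu]_x `|gam (tau (s_ k)) x - gam (tau al) x| * \int[mu]_x `|G x|.
have s0 k : 0 < s_ k by exact: le_lt_trans (als k).
have mu_ : measurable_fun [set: R] u.
  apply: (@measurable_fun_cvg _ _ _ _ (fun k => w (s_ k))).
    by move=> k; exact: L1_measurable (w_L1 (s0 k)).
  move=> x _; have [x0|x0] := leP x 0.
    rewrite su // (_ : (fun k => _) = cst 0); first exact: cvg_cst.
    by apply/funext => k; rewrite w_supp.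
  by move/cvg_at_rightP : (wu _ x0); apply; split.
(* The convergence of [w s] to [u] is only pointwise and its convergence to [n] only in [L1]; Fatou
   with bounds tending to 0 identifies the two limits almost everywhere. *)
have [fi f0] : L1 mu (fun x => `|u x - n x|) /\ \int[mu]_x `|u x - n x| <= 0.
  apply: (@Rfatou _ _ _ mu (fun k x => `|w (s_ k) x - n x|) _ c_).
  - by move=> k; apply: L1_norm; apply: L1B => //; exact: w_L1.
  - by [].
  - move=> x; apply: cvg_norm; apply: cvgB; last exact: cvg_cst.
    have [x0|x0] := leP x 0.
      rewrite su // (_ : (fun k => _) = cst 0); first exact: cvg_cst.
      by apply/funext => k; rewrite w_supp.
    by move/cvg_at_rightP : (wu _ x0); apply; split.
  - move=> k; have gk := gamL1 _ (ltW (als k)); have ga := gamL1 _ (lexx al).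
    rewrite (@ae_eq_Rintegral _ _ _ mu _ (fun x => `|conv (fun y => gam (tau (s_ k)) y - gam
      (tau al) y) G x|)).
    + by apply: Rintegral_norm_conv => //; exact: L1B.
    + by apply: L1_measurable (L1_norm (L1B (w_L1 (s0 k)) ni)).
    + by apply: L1_measurable (L1_norm (L1_conv (L1B gk ga) Gi)).
    + apply: ae_impl2 (wE _ (als k) (st k)) (conv_subl gk ga Gi) _ => x -> <-.
      by [].
  - rewrite -[X in _ --> X](mul0r (\int[mu]_x `|G x|)).
    by apply: cvgM; [exact: gc|exact: cvg_cst].
have un0 : {ae mu, forall x, u x - n x = 0}.
  apply: Rintegral_norm_eq0 f0; apply: L1_le fi => //.
  by apply: measurable_funB => //; exact: L1_measurable ni.
have un : {ae mu, forall x, n x = u x}.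
  by apply: ae_impl un0 _ => x /eqP; rewrite subr_eq0 => /eqP.
split; first exact: L1_ae_eq ni mu_ un.
move=> l l0; rewrite -(lap_ae_eq l (L1_measurable ni) mu_ un) /n.
rewrite lap_conv ?(ltW l0) //; [|exact: gamL1|exact: pos_supp_gamma_density].
rewrite lap_gamma_density ?(ltW l0) ?tau0 // lG // ePhi // !mulrA -!expRD.
rewrite -[LHS]mul1r -[X in X * _ = _]expR0; congr (expR _ * _); rewrite /tau; ring.
Qed.

Definition locally_bounded (r : R) : Prop :=
  exists2 d, 0 < d & exists N : R, forall s : R, 0 < s -> `|s - r| < d -> energy s <= N.

Lemma locally_bounded_open (r : R) : locally_bounded r ->
  exists2 d, 0 < d & forall s : R, `|s - r| < d -> locally_bounded s.
Proof.
move=> [d d0 [N dN]]; exists d => // s sr; exists (d - `|s - r|); first by rewrite subr_gt0.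
exists N => q q0 qs; apply: dN => //.
by rewrite -(subrK s q) -addrA (le_lt_trans (ler_normD _ _)) // -ltrBrDr.
Qed.

(** Instead of a finite cover of [[s, t]]: [W] is locally constant by [evolves_of_bounded], so its
    derivative vanishes and the mean value theorem makes it constant. *)
Lemma evolves_chain (s t : R) : 0 < s -> s <= t ->
  (forall r : R, s <= r <= t -> locally_bounded r) -> evolves s t.
Proof.
move=> s0; rewrite le_eqVlt => /predU1P[<- _ l l0|st lb l l0].
  by rewrite subrr mul0r oppr0 expR0 mul1r.
pose W r := expR (r * Phi l) * lap l (w r).
have WE (r q : R) : evolves r q -> W q = W r.
  by move=> /(_ l l0) h; rewrite /W h mulrA -expRD; congr (expR _ * _); ring.
have dW (r : R) : s <= r <= t -> is_derive r 1 W 0.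
  move=> rst; have r0 : 0 < r by case/andP: rst => sr _; exact: lt_le_trans sr.
  have [d d0 [N dN]] := lb r rst.
  apply: (@near_eq_is_derive _ _ _ (cst (W r))).
  have e0 : 0 < Num.min d r by rewrite lt_min d0 r0.
  near=> q.
  have : `|r - q| < Num.min d r by near: q; apply: cvgr_dist_lt => //; exact: cvg_id.
  rewrite lt_min => /andP[qd qr].
  have q0 : 0 < q by move: qr; rewrite ltr_norml => /andP[? ?]; lra.
  have [rq|qr'] := leP r q.
    rewrite /= (WE r q) //; apply: (@evolves_of_bounded r q N) => // x /andP[x1 x2].
    apply: dN; first exact: lt_le_trans x1.
    move: qd; rewrite !ltr_norml => /andP[? ?]; apply/andP; split; lra.
  rewrite /= (WE q r) //; apply: (@evolves_of_bounded q r N) => //; first exact: ltW.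
  move=> x /andP[x1 x2]; apply: dN; first exact: lt_le_trans x1.
  move: qd; rewrite !ltr_norml => /andP[? ?]; apply/andP; split; lra.
have cW : {within `[s, t], continuous W}.
  apply: continuous_in_subspaceT => r; rewrite inE /= in_itv /= => rst.
  by have d := dW r rst; apply: differentiable_continuous; apply/derivable1_diffP; exact: ex_derive.
have dW' r : r \in `]s, t[%R -> is_derive r 1 W ((cst 0 : R -> R) r).
  by rewrite in_itv /= => /andP[sr rt]; apply: dW; rewrite !ltW.
have [c _] := MVT st dW' cW.
rewrite mul0r => /eqP; rewrite subr_eq0 => /eqP WE'.
have -> : lap l (w t) = expR (- (t * Phi l)) * W t.
  by rewrite /W mulrA -expRD addNr expR0 mul1r.
by rewrite WE' /W mulrA -expRD; congr (expR _ * _); ring.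
Unshelve. all: by end_near. Qed.

(** The energy may be unbounded near [al], so chaining stops short of it. An intermediate time [t'],
    within [(2 * a)^-1] of [al], is linked to [al] by [evolves_left_limit] and to [t] by
    chaining. *)
Lemma evolves_gap (al t : R) : 0 < al -> al < t ->
  (forall r : R, al < r -> r <= t -> locally_bounded r) -> evolves al t.
Proof.
move=> al0 alt lb; pose t' := Num.min t (al + (2 * a)^-1).
have a2 : 0 < (2 * a)^-1 by rewrite invr_gt0 mulr_gt0.
have alt' : al < t' by rewrite lt_min alt ltrDl.
have t't : t' <= t by rewrite ge_min lexx.
have at1 : a * (t' - al) < 1.
  apply: (@le_lt_trans _ _ (a * (2 * a)^-1)).
    by rewrite ler_wpM2l ?(ltW a0) // lerBlDl ge_min lexx orbT.
  by rewrite invfM mulrCA divff ?gt_eqF // mulr1 invf_lt1 // ltr1n.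
have chain (s : R) : al < s -> s <= t -> evolves s t.
  move=> als st; apply: evolves_chain => //; first exact: lt_trans als.
  by move=> r /andP[sr rt]; apply: lb => //; exact: lt_le_trans sr.
have chain' (s : R) : al < s -> s < t' -> evolves s t'.
  move=> als st; apply: evolves_chain; [exact: lt_trans als|exact: ltW|].
  by move=> r /andP[sr rt]; apply: lb; [exact: lt_le_trans sr|exact: le_trans t't].
have lim (x : R) : 0 < x -> w s x @[s --> al^'+] --> w al x.
  by move=> x0; apply: cvg_at_right_filter; exact: (w_cont_t w_C1 al0 x0).
have [_ e1] := evolves_left_limit (ltW al0) alt' at1 chain' lim (w_supp al0).
by apply: (evolves_trans _ (chain t' alt' t't)) => l l0; exact: e1.
Qed.

Lemma energy_gt_open (t N : R) : 0 < t -> N < energy t ->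
  exists2 d, 0 < d & forall r : R, `|r - t| < d -> N < energy r.
Proof.
move=> t0 Nt; apply: contrapT => h.
have pick (n : nat) : exists r : R, `|r - t| < t / n.+1%:R /\ energy r <= N.
  apply: contrapT => hr; apply: h; exists (t / n.+1%:R); first by rewrite divr_gt0.
  by move=> r rt; rewrite ltNge; apply/negP => rN; apply: hr; exists r.
have [r_ hr] := choice pick.
have : energy t <= N.
  apply: (@energy_lsc r_) => //.
  - move=> n; have [h1 _] := hr n.
    have : `|r_ n - t| < t by apply: lt_le_trans h1 _;
      rewrite ler_pdivrMr // ler_peMr ?ler1n // ltW.
    by rewrite ltr_norml => /andP[? ?]; lra.
  - apply/cvgrPdist_lt => e e0; near=> n.
    rewrite distrC; apply: lt_trans (hr n).1 _.
    near: n; have := @invS_cvg0 R t; move/cvgrPdist_lt => /(_ _ e0).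
    by apply: filterS => n; rewrite sub0r normrN; apply: le_lt_trans; exact: ler_norm.
  - by move=> n; exact: (hr n).2.
by rewrite leNgt Nt.
Unshelve. all: by end_near. Qed.

(* Baire category argument: a finite lower semicontinuous function cannot exceed
   every bound on every portion of [K]. *)
Lemma energy_bounded_portion (K : set R) : (forall k, K k -> 0 < k) -> K !=set0 ->
  exists k d N : R, [/\ K k, 0 < d & forall r : R, K r -> `|r - k| < d -> energy r <= N].
Proof.
move=> K0 [k0 Kk0]; apply: contrapT => h.
(* Centres in [K] with radii, for a sequence of nested closed intervals. By [energy_gt_open] the
   bound [n%:R < energy x] holds on whole intervals of the line, so the energy would exceed every
   integer at their common point, the supremum of the left ends. *)
pose S := {p : R * R | K p.1 /\ 0 < p.2}.
have step (n : nat) (p : S) : exists q : S,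
    `|(sval q).1 - (sval p).1| + (sval q).2 < (sval p).2 /\
    (forall x : R, `|x - (sval q).1| <= (sval q).2 -> n%:R < energy x).
  case: p => [[c r] [/= Kc r0]].
  have [c' [Kc' c'c Nc']] : exists c', [/\ K c', `|c' - c| < r & n%:R < energy c'].
    apply: contrapT => hc; apply: h; exists c, r, n%:R; split => // x Kx xc.
    by rewrite leNgt; apply/negP => nx; apply: hc; exists x.
  have [d d0 dn] := energy_gt_open (K0 _ Kc') Nc'.
  have m0 : 0 < Num.min d (r - `|c' - c|) by rewrite lt_min d0 subr_gt0.
  have m1 : Num.min d (r - `|c' - c|) <= d by rewrite ge_min lexx.
  have m2 : Num.min d (r - `|c' - c|) <= r - `|c' - c| by rewrite ge_min lexx orbT.
  have r'0 : 0 < Num.min d (r - `|c' - c|) / 2 by rewrite divr_gt0.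
  exists (exist _ (c', Num.min d (r - `|c' - c|) / 2) (conj Kc' r'0)) => /=; split; first by lra.
  by move=> x xc; apply: dn; lra.
have [next nextP] := choice (fun np : nat * S => step np.1 np.2).
have p0 : S by exists (k0, 1).
pose q := fix q n := if n is m.+1 then next (m, q m) else p0.
pose c n := (sval (q n)).1; pose r n := (sval (q n)).2.
have r0 n : 0 < r n by rewrite /r; case: (svalP (q n)).
have cr n : `|c n.+1 - c n| + r n.+1 < r n by have [] := nextP (n, q n).
have Ec n x : `|x - c n.+1| <= r n.+1 -> n%:R < energy x.
  by have [_ hx] := nextP (n, q n); exact: hx.
have incr n m : c n - r n <= c (n + m)%N - r (n + m)%N /\ c (n + m)%N + r (n + m)%N <= c n + r n.
  elim: m => [|m [IH1 IH2]]; first by rewrite addn0.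
  rewrite addnS; have := cr (n + m)%N; have := ler_norm (c (n + m).+1 - c (n + m)%N).
  have := ler_norm (c (n + m)%N - c (n + m).+1); rewrite distrC => ? ? ?; split; lra.
have ab n m : c n - r n <= c m + r m.
  have [h1 _] := incr n m; have [_ h2] := incr m n; rewrite addnC in h2.
  have := r0 (n + m)%N; lra.
pose A := [set c n - r n | n in setT].
have A0 : A !=set0 by exists (c 0%N - r 0%N); exists 0%N.
have supA : has_sup A.
  by split => //; exists (c 0%N + r 0%N) => _ [n _ <-]; exact: ab.
pose x := sup A.
have xr n : `|x - c n| <= r n.
  have h1 : c n - r n <= x by apply: ub_le_sup; [exact: supA.2|exists n].
  have h2 : x <= c n + r n by apply: ge_sup => // _ [m _ <-]; exact: ab.
  by rewrite ler_norml; apply/andP; split; lra.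
have := Ec (Num.trunc (energy x)).+1 x (xr _).
by rewrite ltNge ltW // truncnS_gt.
Qed.

(* Otherwise [energy] is bounded by some [N] on a portion of the closed set of bad
   points. A good point [r] near it lies in a gap of that set whose left end [al] is
   bad (or in the first, harmless, gap), and since [energy] decreases along the
   evolution from [al], [energy r <= energy al <= N]: the portion is not bad. *)
Lemma all_locally_bounded (t : R) : 0 < t -> locally_bounded t.
Proof.
move=> t0; apply: contrapT => nlb.
pose K := [set k : R | 0 < k /\ ~ locally_bounded k].
have [||k [d [N [[k0 nk] d0 kN]]]] := @energy_bounded_portion K.
- by move=> k [].
- by exists t.
have [e [e0 ed ek]] : exists e, [/\ 0 < e, e < d & e < k].
  have m0 : 0 < Num.min d k by rewrite lt_min d0.
  have m1 : Num.min d k <= d by rewrite ge_min lexx.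
  have m2 : Num.min d k <= k by rewrite ge_min lexx orbT.
  by exists (Num.min d k / 2); split; [rewrite divr_gt0|lra|lra].
pose c := k - e; have c0 : 0 < c by rewrite subr_gt0.
(* [energy c] bounds the energy at those [r] with no bad point between [c] and [r]; [N] takes care
   of all the others. *)
apply: nk; exists e => //; exists (Num.max N (energy c)) => r r0 rk.
have [rk1 rk2] : c < r /\ r < k + e by move: rk; rewrite /c ltr_norml => /andP[? ?]; split; lra.
rewrite le_max; have [lbr|nlbr] := pselect (locally_bounded r); last first.
  by apply/orP; left; apply: kN; [split|apply: lt_trans ed].
pose A := [set x : R | K x /\ c <= x <= r].
have [A0|/set0P/negP] := pselect (A !=set0); last first.
  rewrite negbK => /eqP A0; apply/orP; right; apply: evolves_energy => //; first exact: ltW.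
  apply: evolves_chain => //; first exact: ltW.
  move=> x /andP[cx xr]; apply: contrapT => nx.
  have : A x by split; [split => //; exact: lt_le_trans cx|rewrite cx].
  by rewrite A0.
have supA : has_sup A by split => //; exists r => x [_ /andP[]].
pose al := sup A.
have alr : al <= r by apply: ge_sup => // x [_ /andP[]].
have cal : c <= al.
  have [x Ax] := A0; have [_ /andP[cx _]] := Ax.
  by apply: le_trans cx _; apply: ub_le_sup => //; exact: supA.2.
have al0 : 0 < al by exact: lt_le_trans cal.
(* The bad points form a closed set, so the supremum of those in [[c, r]] is bad. *)
have nal : ~ locally_bounded al.
  move=> /locally_bounded_open[dl dl0 lbs].
  have [x Ax xal] := sup_adherent dl0 supA.
  have xle : x <= al by apply: ub_le_sup => //; exact: supA.2.
  have [[_ nx] _] := Ax; apply: nx; apply: lbs.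
  rewrite ler0_norm ?subr_le0 // opprB; move: xal; rewrite -/al; lra.
have Kal : K al by split.
have alN : energy al <= N.
  by apply: kN => //; rewrite ltr_norml; apply/andP; split; move: cal alr; rewrite /c; lra.
apply/orP; left; apply: le_trans alN.
have {}alr : al < r by rewrite lt_neqAle alr andbT; apply/eqP => alE; rewrite alE in nal.
apply: evolves_energy => //; first exact: ltW.
apply: evolves_gap => // x alx xr; apply: contrapT => nx.
have Ax : A x.
  by split; [split => //; exact: lt_trans alx|rewrite xr andbT (le_trans cal) // ltW].
by have := ub_le_sup supA.2 Ax; rewrite leNgt alx.
Qed.

(** [evolves_left_limit] reaches time 0 only from times below [1 / a]; later times are linked to
    such a time by the law on []0, +oo[]. *)
Lemma evolves_from_initial (u : R -> R) : pos_supp u ->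
  (forall x : R, 0 < x -> w s x @[s --> 0^'+] --> u x) ->
  L1 mu u /\ forall t l : R, 0 < t -> 0 < l -> lap l (w t) = expR (- (t * Phi l)) * lap l u.
Proof.
move=> su wu.
have ev (s t : R) : 0 < s -> s <= t -> evolves s t.
  move=> s0 st; apply: evolves_chain => // r /andP[sr _].
  by apply: all_locally_bounded; exact: lt_le_trans sr.
have start (t : R) : 0 < t -> a * t < 1 ->
    L1 mu u /\ forall l : R, 0 < l -> lap l (w t) = expR (- (t * Phi l)) * lap l u.
  move=> t0 at1.
  have at1' : a * (t - 0) < 1 by rewrite subr0.
  have chain (s : R) : 0 < s -> s < t -> evolves s t by move=> s0 /ltW; exact: ev.
  have := evolves_left_limit (lexx 0) t0 at1' chain wu su.
  by rewrite subr0.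
have a2 : 0 < (2 * a)^-1 by rewrite invr_gt0 mulr_gt0.
have aa : a * (2 * a)^-1 < 1.
  by rewrite invfM mulrCA divff ?gt_eqF // mulr1 invf_lt1 // ltr1n.
have [ui _] := start _ a2 aa; split => // t l t0 l0.
pose s := Num.min t (2 * a)^-1.
have s0 : 0 < s by rewrite lt_min t0.
have as1 : a * s < 1 by apply: le_lt_trans aa; rewrite ler_wpM2l ?(ltW a0) // ge_min lexx orbT.
have st : s <= t by rewrite ge_min lexx.
have [_ h] := start _ s0 as1.
rewrite (ev s t s0 st l l0) h // mulrA -expRD; congr (expR _ * _); ring.
Qed.

End evolution.

(** * From the boundary value problem to the representation formulas *)

Section solution_laplace.
Context {R : realType}.
Local Notation mu := (@lebesgue_measure R).
Variables (a b : R) (f : R -> R) (v : R -> R -> R).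
Hypotheses (a0 : 0 < a) (b0 : 0 < b).
Hypothesis hv : C11_W11_0 v.
Hypothesis hsol : gamma_problem_solution a b f v.
Local Notation p := (pos_levy_tail a b).
Local Notation Phi := (gamma_exponent a b).

Lemma solution_pos_supp (t : R) : 0 < t -> pos_supp (v t).
Proof. by case: hsol => _ _ v0 t0 x x0; exact: v0. Qed.

Lemma solution_prim (t : R) : 0 < t -> exists g,
  [/\ L1 mu g, pos_supp g, L1 mu (v t) & v t = prim g].
Proof.
move=> t0; have [_ _ _ /(_ t t0)/W11_0_prim[g [gi sg vi vE]]] := hv.
exists g; split => //.
  rewrite (_ : v t = (v t) \_ `]0, +oo[) //; apply/funext => x.
  have [x0|x0] := leP x 0; first by rewrite solution_pos_supp // pos_supp_restrict.
  by rewrite restrict_pos.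
apply/funext => x; have [x0|x0] := leP 0 x; first exact: vE.
by rewrite solution_pos_supp ?(ltW x0) // prim_le0 // ltW.
Qed.

Lemma solution_continuous (t x : R) : 0 < t -> 0 < x -> {for x, continuous (v t)}.
Proof.
move=> t0 x0; have [_ _ /(_ t t0 x x0)[dv _] _] := hv.
by apply: differentiable_continuous; apply/derivable1_diffP.
Qed.

Lemma solution_C1 (x : R) : 0 < x -> C1_pos (v ^~ x).
Proof. by move=> x0; case: hv => _ h _ _; exact: h. Qed.

(** The equation makes the time derivative equal to [- conv g p] almost everywhere, with [g] the
    [x]-derivative of [v t]. The factor [l] from [lap_prim] cancels the [1 / l] in the transform of
    the tail. *)
Lemma solution_time_derivative (t : R) : 0 < t -> L1 mu (time_derivative v t) /\
  forall l : R, 0 < l -> lap l (time_derivative v t) = - Phi l * lap l (v t).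
Proof.
move=> t0; have [g [gi sg vi vE]] := solution_prim t0.
have pi := L1_pos_levy_tail a0 b0; have sp := @pos_supp_pos_levy_tail _ a b.
pose k x := -1 * conv g p x.
have ki : L1 mu k by apply: L1Z; exact: L1_conv.
have mD : measurable_fun [set: R] (time_derivative v t).
  have := measurable_fun_pair2 t (measurable_pos_part2_derive solution_continuous solution_C1).
  by congr measurable_fun; apply/funext => x; rewrite /pos_part2 /time_derivative /= t0.
have kD : {ae mu, forall x, k x = time_derivative v t x}.
  have := RL_operator_prim a0 b0 gi sg vi vE => h; apply: ae_impl h _ => x h.
  rewrite /k mulN1r /time_derivative; have [x0|x0] := ltP 0 x; last first.
    by rewrite (pos_supp_conv sg sp) ?oppr0.
  by have [dv _ _] := hsol; rewrite dv // h.
split; first exact: L1_ae_eq ki mD kD.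
move=> l l0; rewrite -(lap_ae_eq l (L1_measurable ki) mD kD) /k lapZ; last exact: L1_conv.
rewrite lap_conv ?(ltW l0) // lap_prim // -vE lap_pos_levy_tail //.
by field; rewrite gt_eqF.
Qed.

Lemma solution_derivative_lap (t : R) : 0 < t -> exists2 g : R -> R, L1 mu g /\ pos_supp g &
  forall l : R, 0 < l -> lap l g = l * lap l (v t).
Proof.
move=> t0; have [g [gi sg vi vE]] := solution_prim t0; exists g => // l l0.
by rewrite lap_prim // -vE.
Qed.

(* Both sides of the representation formula are primitives of [L1] functions,
   so equality of Laplace transforms, hence equality almost everywhere, of
   these functions gives equality at every point. *)
Lemma solution_eq_prim (g k : R -> R) (t : R) : 0 < t -> L1 mu g -> pos_supp g ->
  f \_ `]0, +oo[ = prim g -> L1 mu k -> pos_supp k ->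
  (forall l : R, 0 < l -> lap l k = expR (- (t * Phi l)) * lap l g) ->
  v t = prim k.
Proof.
move=> t0 gi sg fg ki sk lk.
have [gt [gti sgt vi vE]] := solution_prim t0.
have wL1 (s : R) : 0 < s -> L1 mu (v s) by move=> /solution_prim[? []].
have DL1 (s : R) : 0 < s -> L1 mu (time_derivative v s) by move=> /solution_time_derivative[].
have lD (s l : R) : 0 < s -> 0 < l -> lap l (time_derivative v s) = - Phi l * lap l (v s).
  by move=> /solution_time_derivative[_ h] /h.
have v0 (x : R) : 0 < x -> v s x @[s --> 0^'+] --> (f \_ `]0, +oo[) x.
  by move=> x0; rewrite restrict_pos //; case: hsol => _ /(_ x x0)[<-].
have [_ lv] := evolves_from_initial a0 b0 wL1 solution_pos_supp solution_continuous
  solution_C1 DL1 lD solution_derivative_lap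
  (@pos_supp_restrict _ f) v0.
have gk : {ae mu, forall x, gt x = k x}.
  apply: lerch => // l l0; rewrite lk // (lap_prim gti sgt l0) (lap_prim gi sg l0) -fg -vE lv
    //; ring.
rewrite vE; apply/funext => x; rewrite !primE; apply: ae_eq_Rintegral.
- by apply: measurable_funM; [exact: L1_measurable gti|exact: measurable_indic].
- by apply: measurable_funM; [exact: L1_measurable ki|exact: measurable_indic].
- by apply: ae_impl gk _ => y ->.
Qed.

Lemma solution_conv (t x : R) : W11_0 f -> 0 < t -> 0 < x ->
  v t x = \int[mu]_(y in `[0, x]) (f (x - y) * gamma_density a b t y).
Proof.
move=> hf t0 x0; have [g [gi sg fi fg]] := W11_0_prim hf.
have [_ _ f0] := hf.
have f0E : f \_ `]0, +oo[ = prim g.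
  apply/funext => y; have [y0|y0] := leP y 0; last by rewrite restrict_pos // fg // ltW.
  by rewrite pos_supp_restrict // prim_le0.
have gami := L1_gamma_density a0 b0 t0; have sgam := @pos_supp_gamma_density _ a b t.
have lk (l : R) : 0 < l -> lap l (conv g (gamma_density a b t)) = expR (- (t * Phi l)) * lap l g.
  by move=> l0; rewrite lap_conv ?(ltW l0) // lap_gamma_density ?(ltW l0) // mulrC.
rewrite (solution_eq_prim t0 gi sg f0E (L1_conv gi gami) (pos_supp_conv sg sgam) lk).
rewrite prim_conv // -f0E /conv -[RHS]Rintegral_indic_mul; apply: eq_Rintegral => y _.
rewrite indicE mem_setE in_itv /=.
have [y0|y0] := leP y 0; first by rewrite !sgam // !mulr0.
rewrite (ltW y0) /=; have [yx|xy] := leP y x; last first.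
  by rewrite pos_supp_restrict ?subr_le0 ?(ltW xy) // !mul0r.
(* At the end point [y = x] the restriction to []0, +oo[] is 0, and so is [f 0]. *)
rewrite mul1r; congr (_ * _); move: yx; rewrite le_eqVlt => /predU1P[->|yx].
  by rewrite subrr f0 pos_supp_restrict.
by rewrite restrict_pos // subr_gt0.
Qed.

Section expectation.
Context {d : measure_display} {T : measurableType d} (P : probability T R).
Variables (X : T -> R) (t : R).
Hypotheses (mX : measurable_fun [set: T] X) (X0 : forall w, 0 <= X w) (t0 : 0 < t).
Hypothesis lX : forall l : R, 0 < l -> \int[P]_w expR (- (l * X w)) = expR (- (t * Phi l)).

(** The law of [X] enters only through its Laplace transform: [kE z], the expectation of
    [g (z - X)], has transform [expR (- (t * Phi l)) * lap l g], so [v t = prim kE]. Fubini then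
    moves the primitive inside the expectation, where it turns [g] into [f]. *)
Lemma solution_expectation (x : R) : W11_0 f ->
  L1 P (fun w => (f \_ `]0, +oo[) (x - X w)) /\
  v t x = \int[P]_w (f \_ `]0, +oo[) (x - X w).
Proof.
move=> hf; have [g [gi sg fi fg]] := W11_0_prim hf.
have f0E : f \_ `]0, +oo[ = prim g.
  apply/funext => y; have [y0|y0] := leP y 0; last by rewrite restrict_pos // fg // ltW.
  by rewrite pos_supp_restrict // prim_le0.
have mg := L1_measurable gi.
pose K (q : T * R) := g (q.2 - X q.1).
have mK : measurable_fun setT K.
  apply: (measurableT_comp mg); apply: measurable_funB; first exact: measurable_snd.
  by apply: (measurableT_comp mX); exact: measurable_fst.
have LK : L1 (P \x mu)%E K.
  apply/integrable12ltyP; first exact/measurable_EFinP.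
  move/integrableP: (gi) => [mG gfin].
  rewrite (eq_integral (fun=> \int[mu]_z `|(g z)%:E|)%E).
    rewrite integral_cst //= [X in (_ * X)%E](_ : _ = 1%E) ?mule1 //.
    exact: probability_setT.
  move=> w _; rewrite -(@integral_shift _ (fun z => `|(g z)%:E|%E) (X w)) //.
  exact: measurableT_comp.
have LKm (h : R -> R) : measurable_fun [set: R] h -> (forall z, 0 < z -> `|h z| <= 1) ->
    L1 (P \x mu)%E (fun q => h q.2 * K q).
  move=> mh h1; apply: L1_le (L1_norm LK).
    by apply: measurable_funM => //; apply: (measurableT_comp mh); exact: measurable_snd.
  move=> q; rewrite normrM; have [q0|q0] := leP q.2 0.
    by rewrite /K sg ?normr0 ?mulr0 // subr_le0 (le_trans q0).
  by rewrite ler_piMl // h1.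
pose kE z := \int[P]_w K (w, z).
have kEi : L1 mu kE by exact: Rfubini_F_L1 (L1_swap LK).
have skE : pos_supp kE.
  move=> z z0; rewrite /kE; under eq_Rintegral => w _.
    rewrite /K /= sg; last by rewrite subr_le0 (le_trans z0).
    over.
  by rewrite /= Rintegral_cst // mul0r.
have mKz z : measurable_fun [set: T] (fun w => K (w, z)) by exact: measurable_fun_pair1 z mK.
have lkE (l : R) : 0 < l -> lap l kE = expR (- (t * Phi l)) * lap l g.
  move=> l0; have L := LKm _ (measurable_exp l).
  have {}L : L1 (P \x mu)%E (fun q => expR (- (l * q.2)) * K q).
    apply: L => z z0; rewrite ger0_norm ?expR_ge0 // -expR0 ler_expR oppr_le0.
    by rewrite mulr_ge0 // ltW.
  transitivity (\int[mu]_z \int[P]_w (expR (- (l * z)) * K (w, z))).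
    by apply: eq_Rintegral => z _; rewrite Rintegral_scale.
  rewrite -(Rfubini L) /= -lX // mulrC -Rintegral_scale //; last first.
    apply: (measurableT_comp (f := fun y : R => expR (- (l * y)))) => //.
    exact: measurable_exp.
  apply: eq_Rintegral => w _; rewrite mulrC.
  transitivity (\int[mu]_z (expR (- (l * X w)) * (expR (- (l * (z - X w))) * g (z - X w)))).
    by apply: eq_Rintegral => z _; rewrite /K /= mulrA -expRD; congr (expR _ * _); ring.
  have me : measurable_fun [set: R] (fun z => expR (- (l * z)) * g z).
    by apply: measurable_funM => //; exact: measurable_exp.
  rewrite Rintegral_scale //; last exact: (measurable_shift (X w) me).
  by rewrite (Rintegral_shift (X w) me).
have LI := LKm (\1_`]-oo, x]) (measurable_indic _).
have {}LI : L1 (P \x mu)%E (fun q => \1_`]-oo, x] q.2 * K q).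
  apply: LI; first exact: measurable_itv.
  by move=> z _; rewrite indicE; case: (_ \in _); rewrite ?normr1 ?normr0.
have inner w : \int[mu]_z (\1_`]-oo, x] z * K (w, z)) = prim g (x - X w).
  rewrite primE -(@Rintegral_shift _ (fun u => g u * \1_`]-oo, x - X w] u) (X w)); last first.
    by apply: measurable_funM => //; exact: measurable_indic.
  apply: eq_Rintegral => z _; rewrite /K /= mulrC !indicE !mem_setE !in_itv /=.
  by rewrite lerD2r.
split.
  rewrite f0E (_ : (fun w => _) = fun w => \int[mu]_z (\1_`]-oo, x] z * K (w, z))).
    exact: Rfubini_F_L1 LI.
  by apply/funext => w; rewrite inner.
rewrite (solution_eq_prim t0 gi sg f0E kEi skE lkE) primE f0E.
transitivity (\int[mu]_z \int[P]_w (\1_`]-oo, x] z * K (w, z))).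
  by apply: eq_Rintegral => z _; rewrite Rintegral_scale // mulrC.
by rewrite -(Rfubini LI); apply: eq_Rintegral => w _; rewrite inner.
Qed.

End expectation.
End solution_laplace.

(** * The probabilistic representation *)

Section ae_integral.
Context {d : measure_display} {T : measurableType d} {R : realType}.
Variable mu : {measure set T -> \bar R}.
Local Open Scope ereal_scope.

(** Holds without measurability, since the integral of a nonnegative function is a supremum over the
    simple functions below it. *)
Lemma le_integral_ge0 (f g : T -> \bar R) : (forall x, 0 <= f x) ->
  (forall x, f x <= g x) -> \int[mu]_x f x <= \int[mu]_x g x.
Proof.
move=> f0 fg; have g0 x : 0 <= g x by exact: le_trans (fg x).
rewrite !ge0_integralTE //; apply: le_ereal_sup => _ [h hf <-]; exists h => //.
by move=> x; exact: le_trans (hf x) (fg x).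
Qed.

(* [f] need not be measurable: [mu] is not assumed to be complete. *)
Lemma ge0_ae_eq_integral_measurable_right (f g : T -> \bar R) :
  (forall x, 0 <= f x) -> (forall x, 0 <= g x) -> measurable_fun setT g ->
  {ae mu, forall x, f x = g x} -> \int[mu]_x f x = \int[mu]_x g x.
Proof.
move=> f0 g0 mg [N [mN N0 fgN]].
have fgE x : ~ N x -> f x = g x by move=> nx; apply: contrapT => fgx; exact/nx/fgN.
(* Measurable bounds below and above [f], equal to [g] off the null set and to 0 and [+oo] on it. *)
pose lo := g \_ (~` N); pose up x := lo x + ((cst +oo) \_ N) x.
have mlo : measurable_fun setT lo.
  by apply/(measurable_restrictT g (measurableC mN)); exact: measurable_funS mg.
have mup : measurable_fun setT up.
  apply: emeasurable_funD => //.
  by apply/(measurable_restrictT _ mN); exact: measurable_cst.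
have loE x : ~ N x -> lo x = g x by move=> nx; rewrite /lo patchE mem_set.
have loN x : N x -> lo x = 0 by move=> nx; rewrite /lo patchE memNset //; exact.
have upE x : ~ N x -> up x = g x.
  by move=> nx; rewrite /up loE // patchE memNset // adde0.
have upN x : N x -> up x = +oo.
  by move=> nx; rewrite /up loN // patchE mem_set // add0e.
have lo0 x : 0 <= lo x by have [/loN->|/loE->] := pselect (N x).
have up0 x : 0 <= up x by have [/upN->|/upE->] := pselect (N x).
have ae_lo : ae_eq mu setT lo g.
  exists N; split => // x /= /not_implyP[_]; apply: contra_notP => nx.
  by rewrite loE.
have ae_up : ae_eq mu setT up g.
  exists N; split => // x /= /not_implyP[_]; apply: contra_notP => nx.
  by rewrite upE.
apply/eqP; rewrite eq_le; apply/andP; split.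
- rewrite -(ge0_ae_eq_integral measurableT mup mg _ _ ae_up) //.
  apply: le_integral_ge0 => // x.
  by have [/upN->|nx] := pselect (N x); [exact: leey|rewrite upE // fgE].
- rewrite -(ge0_ae_eq_integral measurableT mlo mg _ _ ae_lo) //.
  apply: le_integral_ge0 => // x.
  by have [/loN->|nx] := pselect (N x); [exact: f0|rewrite loE // fgE].
Qed.

End ae_integral.

Section gamma_paths.
Context {d : measure_display} {T : measurableType d} {R : realType}.
Variables (P : probability T R) (H : R -> {RV P >-> R}) (a b : R).
Hypotheses (a0 : 0 < a) (b0 : 0 < b) (hH : gamma_subordinator H a b).
Local Notation Phi := (gamma_exponent a b).

Let mH (t : R) : measurable_fun [set: T] (H t).
Proof. exact: measurable_funP. Qed.

Let mexpH (t l : R) : measurable_fun [set: T] (fun w => expR (- (l * H t w))).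
Proof.
apply: (measurableT_comp (f := fun y : R => expR (- (l * y)))); last exact: mH.
exact: measurable_exp.
Qed.

Let lapH (t l : R) : 0 <= t -> 0 <= l ->
  (\int[P]_w (expR (- (l * H t w)))%:E = (expR (- (t * Phi l)))%:E)%E.
Proof. by move=> t0 l0; have [_ /(_ t l t0 l0)] := hH; rewrite unlock. Qed.

(** A Chernoff bound: the probability of [H s <= 0] is at most [expR (- (s * Phi l))] for every
    [l >= 0], and [Phi] is unbounded. *)
Lemma gamma_subordinator_gt0_ae (s : R) : 0 < s -> {ae P, forall w, 0 < H s w}.
Proof.
move=> s0; pose A := [set w | H s w <= 0].
have mA : measurable A.
  rewrite (_ : A = H s @^-1` `]-oo, 0]); last by apply/seteqP; split => w /=; rewrite in_itv.
  by rewrite -[X in measurable X]setTI; exact: mH.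
exists A; split => //; last by move=> w /=; rewrite /A /= => /negP; rewrite -leNgt.
apply/eqP; rewrite eq_le measure_ge0 andbT; apply/lee_addgt0Pr => e e0; rewrite add0e.
(* [l] solves [s * Phi l = e^-1], and [expR (- e^-1) <= e]. *)
pose K := (s * a * e)^-1; pose l := b * (expR K - 1).
have K0 : 0 < K by rewrite invr_gt0 !mulr_gt0.
have l0 : 0 <= l by rewrite mulr_ge0 ?(ltW b0) // subr_ge0 -expR0 ler_expR ltW.
have PhiE : s * Phi l = e^-1.
  have -> : Phi l = a * K.
    rewrite /gamma_exponent /l mulrAC divff ?gt_eqF // mul1r.
    by rewrite (_ : 1 + (expR K - 1) = expR K) ?expRK //; ring.
  by rewrite /K; field; rewrite !gt_eqF.
apply: (@le_trans _ _ (expR (- (s * Phi l)))%:E); last first.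
  rewrite lee_fin PhiE expRN -[leRHS]invrK lef_pV2 ?posrE ?expR_gt0 ?invr_gt0 //.
  by apply: le_trans (expR_ge1Dx _); rewrite lerDr.
rewrite -(lapH (ltW s0) l0) -[P A]/(P A) -[A]setIT -integral_indic //.
apply: ge0_le_integral => //.
- exact/measurable_EFinP/measurable_indic.
- by apply/measurable_EFinP; exact: mexpH.
- move=> w _; rewrite lee_fin indicE; have [wA|wA] := boolP (w \in A); last exact: expR_ge0.
  by rewrite -expR0 ler_expR oppr_ge0 mulr_ge0_le0 //; move: wA; rewrite inE.
Qed.

Lemma gamma_subordinator_paths_ae : {ae P, forall w, [/\ forall t : R, 0 <= t -> 0 <= H t w,
  (forall s t : R, 0 <= s -> s <= t -> H s w <= H t w),
  (forall t : R, 0 <= t -> H s w @[s --> t^'+] --> H t w) &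
  (forall s : R, 0 < s -> 0 < H s w)]}.
Proof.
have [[_ _ paths] _] := hH.
(* Countably many times tending to 0 are enough; monotonicity extends positivity to every
   [s > 0]. *)
have pos : {ae P, forall w, forall n : nat, 0 < H n.+1%:R^-1 w}.
  by apply/ae_foralln => n; apply: gamma_subordinator_gt0_ae; rewrite invr_gt0.
apply: ae_impl2 paths pos _ => w [H0 Hmono Hrc] Hpos; split => //.
  by move=> t t0; rewrite -H0; exact: Hmono.
move=> s s0; pose n := Num.trunc s^-1.
apply: lt_le_trans (Hpos n) _; apply: Hmono; first by rewrite invr_ge0.
by rewrite invf_ple ?posrE // ltW // truncnS_gt.
Qed.

Lemma lt_inverse_process (t x : R) (w : T) : 0 < t ->
  (t%:E < inverse_process H x w)%E -> 0 < H t w < x.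
Proof.
move=> t0 tL; apply: contrapT => nH.
have : (inverse_process H x w <= t%:E)%E.
  by apply: ereal_inf_lbound; exists t => //; split => // /=; rewrite in_itv.
by rewrite leNgt tL.
Qed.

(** Right continuity provides a time [s > t] with [H s w < x]. Up to [s] the path stays in []0, x[]
    by monotonicity and positivity, so the infimum is at least [s]; this gives the strict
    inequality. *)
Lemma inverse_process_lt (t x : R) (w : T) : 0 < t ->
  (forall s t : R, 0 <= s -> s <= t -> H s w <= H t w) ->
  H s w @[s --> t^'+] --> H t w -> (forall s : R, 0 < s -> 0 < H s w) ->
  H t w < x -> (t%:E < inverse_process H x w)%E.
Proof.
move=> t0 mono rc pos Hx.
have /filter_ex[s [ts Hs]] : \forall s \near t^'+, t < s /\ H s w < x.
  near=> s; split; first by near: s; exact: nbhs_right_gt.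
  by near: s; move/cvgrPdist_lt : rc => /(_ (x - H t w)); rewrite subr_gt0 => /(_ Hx);
    apply: filterS => s; rewrite ltr_norml => /andP[? ?]; lra.
apply: (@lt_le_trans _ _ s%:E); first by rewrite lte_fin.
apply: le_ereal_inf_tmp => _ [r [r0 rH] <-]; rewrite lee_fin leNgt; apply/negP => rs.
apply: rH; rewrite /= in_itv /= pos //=.
by apply: le_lt_trans Hs; apply: mono; exact: ltW.
Unshelve. all: by end_near. Qed.

Lemma Rintegral_exp_gamma_subordinator (t l : R) : 0 <= t -> 0 <= l ->
  \int[P]_w expR (- (l * Num.max (H t w) 0)) = expR (- (t * Phi l)).
Proof.
move=> t0 l0; transitivity (\int[P]_w expR (- (l * H t w))); last first.
  by rewrite /Rintegral lapH.
apply: ae_eq_Rintegral.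
- apply: (measurableT_comp (f := fun y : R => expR (- (l * y)))); first exact: measurable_exp.
  by apply: measurable_maxr => //; exact: mH.
- exact: mexpH.
- by apply: ae_impl gamma_subordinator_paths_ae _ => w [/(_ t t0) Ht _ _ _]; rewrite max_l.
Qed.

End gamma_paths.

Theorem theorem2 (R : realType) (d : measure_display) (T : measurableType d)
  (P : probability T R) (a b : R) (H : R -> {RV P >-> R})
  (f : R -> R) (v : R -> R -> R)
  (ha : 0 < a) (hb : 0 < b)
  (hH : gamma_subordinator H a b)
  (hf : W11_0 f)
  (hv : C11_W11_0 v)
  (hLv : laplace_class v)
  (hsol : gamma_problem_solution a b f v) :
  forall t x : R, 0 < t -> 0 < x ->
    v t x = \int[lebesgue_measure]_(y in `[0, x])
              (f (x - y) * gamma_density a b t y)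
    /\
    ((v t x)%:E =
      'E_P[(fun w => (f (x - H t w) *
                     \1_[set w' | (t%:E < inverse_process H x w')%E] w)%R)])%E.
Proof.
move=> t x t0 x0; split; first exact: solution_conv.
(* The comparison of expectations is made for nonnegative integrands, because the event [t < L_x] is
   only known to agree almost surely with a measurable one. The sign of [f] is inherited from [v] as
   time decreases to 0. *)
have f_ge0 (y : R) : 0 < y -> 0 <= f y.
  move=> y0; have [_ /(_ y y0)[v0 vc] _] := hsol.
  rewrite -v0 -(cvg_lim _ vc) //; apply: limr_ge; first exact: cvgP vc.
  have [vpos _ _ _] := hv.
  apply: (@filterS _ _ _ (fun s : R => 0 < s)); last exact: nbhs_right_gt.
  by move=> s s0; exact: vpos.
(* [H t] is nonnegative almost surely only, while [solution_expectation] asks for it at every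
   point. *)
pose X w := Num.max (H t w) 0.
have mX : measurable_fun [set: T] X by apply: measurable_maxr => //; exact: measurable_funP.
have X0 w : 0 <= X w by rewrite le_max lexx orbT.
have lX (l : R) : 0 < l -> \int[P]_w expR (- (l * X w)) = expR (- (t * gamma_exponent a b l)).
  by move=> l0; apply: (Rintegral_exp_gamma_subordinator ha hb hH); exact: ltW.
have [iY ->] := solution_expectation ha hb hv hsol mX X0 t0 lX x hf.
have f0_ge0 y : 0 <= (f \_ `]0, +oo[) y.
  by have [y0|y0] := leP y 0; [rewrite pos_supp_restrict|rewrite restrict_pos ?f_ge0].
rewrite unlock (EFin_Rintegral iY); symmetry.
apply: ge0_ae_eq_integral_measurable_right.
- move=> w; rewrite lee_fin indicE.
  have [|_] := boolP (w \in _); last by rewrite mulr0.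
  rewrite inE /= => /(lt_inverse_process t0)/andP[_ Hx].
  by rewrite mulr1 f_ge0 // subr_gt0.
- by move=> w; rewrite lee_fin.
- exact: measurable_int iY.
- apply: ae_impl (gamma_subordinator_paths_ae ha hb hH) _ => w [Hge0 mono rc pos].
  rewrite /X (max_l (Hge0 _ (ltW t0))) indicE; congr EFin.
  have [Hx|xH] := ltP (H t w) x.
    rewrite restrict_pos ?subr_gt0 // mem_set ?mulr1 //=.
    by apply: inverse_process_lt => //; exact: rc (ltW t0).
  rewrite pos_supp_restrict ?subr_le0 // memNset ?mulr0 //=.
  by move=> /(lt_inverse_process t0)/andP[_]; rewrite ltNge xH.
Qed.
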